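(* Let $k$ be a field, let $(V,c)$ be a finite dimensional braided vector space over $k$ that is right triangular with respect to a totally ordered basis $X$ of $V$, and let $I\subsetneq T(V,c)$ be a braided biideal. Then there are a totally ordered subset $S\subset T(V,c)$ and a height function $h:S\to\mathbb N\cup\{\infty\}$ such that the images of the elements of the PBW set generated by $S$ and $h$ form a basis of $T(V,c)/I$. More precisely, let $\tau$ denote the flip map and let $\phi:T(V,c)\to T(V,\tau c\tau)^{op,cop}$ be the isomorphism of braided bialgebras with $\phi(v_1\otimes\dots\otimes v_n)=v_n\otimes\dots\otimes v_1$ for $v_1,\dots,v_n\in V$. Then one has $$S=\phi^{-1}(S_{\phi(I)}),\qquad h=h_{\phi(I)}\circ\phi,$$ and the order on $S$ is the opposite of the order on $S_{\phi(I)}$ (transported via $\phi$).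
   Context: **Braidings.** A braided vector space $(V,c)$ is a vector space $V$ with an automorphism $c$ of $V\otimes V$ satisfying the braid equation $(c\otimes \mathrm{id})(\mathrm{id}\otimes c)(c\otimes \mathrm{id})=(\mathrm{id}\otimes c)(c\otimes \mathrm{id})(\mathrm{id}\otimes c)$. The maps $c_{n,m}:V^{\otimes n}\otimes V^{\otimes m}\to V^{\otimes m}\otimes V^{\otimes n}$ are: identities if $n=0$ or $m=0$, $c_{1,1}=c$, $c_{1,m+1}=(\mathrm{id}_V\otimes c_{1,m})(c\otimes \mathrm{id}_{V^{\otimes m}})$, $c_{n+1,m}=(c_{n,m}\otimes \mathrm{id}_V)(\mathrm{id}_{V^{\otimes n}}\otimes c_{1,m})$; they give a braiding $c$ on $T(V)$. $T(V,c)$ is the tensor algebra with this braiding and the braided bialgebra structure for which $\Delta:T(V)\to T(V)\underline{\otimes}T(V)$ and $\varepsilon$ are algebra morphisms with $\Delta(v)=1\otimes v+v\otimes1$, $\varepsilon(v)=0$ for $v\in V$; here $T(V)\underline{\otimes}T(V)$ is $T(V)\otimes T(V)$ with multiplication $(m\otimes m)(\mathrm{id}\otimes c\otimes\mathrm{id})$. For a braided bialgebra $R=(R,\mu,\eta,\Delta,\varepsilon,c)$, $R^{op,cop}=(R,\mu\tau,\eta,\tau\Delta,\varepsilon,\tau c\tau)$. A braided biideal $I$ of $R$ is an ideal and coideal with $c(R\otimes I+I\otimes R)=R\otimes I+I\otimes R$. **Right triangular.** For $V$ finite dimensional with totally ordered basis $X$, $c$ is right triangular with respect to $X$ if there are $\beta_{x,y}\in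 k$ ($x,y\in X$) and $w_{x,y,z}\in V$ ($x,y,z\in X$, $z>x$) with $c(x\otimes y)=\beta_{x,y}\,y\otimes x+\sum_{z>x}w_{x,y,z}\otimes z$ for all $x,y\in X$. **Words.** $\langle X\rangle$ is the free monoid on $X$, and $T(V)$ is identified with the free algebra $k\langle X\rangle$; $l(u)$ is the length of $u$. Lexicographical order: $u<v$ iff $u$ is a proper beginning of $v$, or $u=ras$, $v=rbt$ with $r,s,t\in\langle X\rangle$, $a,b\in X$, $a<b$. A word $u\ne1$ is Lyndon if $u<w$ for every factorization $u=vw$ with $v,w\neq1$. Standard order: $u\succeq v$ iff $l(u)<l(v)$, or $l(u)=l(v)$ and $u\ge v$ lexicographically; $\langle X\rangle_{\succ u}=\{w:w\succ u\}$. **PBW data.** For a totally ordered subset $(S,<)$ of an algebra and $h:S\to\mathbb N\cup\{\infty\}$, the PBW set generated by $S$ and $h$ is the set of all products $s_1^{e_1}\cdots s_t^{e_t}$ with $t\ge0$, $s_1>\dots>s_t$ in $S$, $0<e_i<h(s_i)$. For a proper biideal $J\subsetneq k\langle X\rangle$: $S_J=\{u\in\langle X\rangle:u\text{ Lyndon},\ u\notin k\langle X\rangle_{\succ u}+J\}$, ordered lexicographically, and $h_J(u)=\min\{t\in\mathbb N:u^t\in k\langle X\rangle_{\succ u^t}+J\}$ for $u\in S_J$ ($\infty$ if there is no such $t$). *)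

(* Defs.v *)
From HB Require Import structures.
From mathcomp Require Import all_boot all_order all_algebra.
From mathcomp Require Import finmap.
From mathcomp.multinomials Require Import monalg.

Set Implicit Arguments.
Unset Strict Implicit.
Unset Printing Implicit Defensive.

Import Order.TTheory GRing.Theory.
Local Open Scope ring_scope.

(* {malg k[A]} is the free k-module on A, with basis the elements << a >>.
   The tensor product of {malg k[A]} and {malg k[B]} is {malg k[A * B]},
   with << (a, b) >> standing for << a >> (x) << b >>. *)
Section FreeModules.

Variable k : fieldType.

Definition lext (A : choiceType) (V : lmodType k) (f : A -> V)
    (a : {malg k[A]}) : V :=
  \sum_(i <- msupp a) a@_i *: f i.

Definition tens (A B : choiceType) (a : {malg k[A]}) (b : {malg k[B]}) :
    {malg k[(A * B)%type]} :=
  \sum_(i <- msupp a) \sum_(j <- msupp b) << a@_i * b@_j *g (i, j) >>.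

(* The map f (x) g, for linear f and g. *)
Definition tmap (A B A' B' : choiceType) (f : {malg k[A]} -> {malg k[A']})
    (g : {malg k[B]} -> {malg k[B']}) :
    {malg k[(A * B)%type]} -> {malg k[(A' * B')%type]} :=
  lext (fun p => tens (f << p.1 >>) (g << p.2 >>)).

Definition flip (A B : choiceType) :
    {malg k[(A * B)%type]} -> {malg k[(B * A)%type]} :=
  lext (fun p => << (p.2, p.1) >>).

Definition assocr (A B C : choiceType) :
    {malg k[(A * B * C)%type]} -> {malg k[(A * (B * C))%type]} :=
  lext (fun p => << (p.1.1, (p.1.2, p.2)) >>).

Definition assocl (A B C : choiceType) :
    {malg k[(A * (B * C))%type]} -> {malg k[(A * B * C)%type]} :=
  lext (fun p => << (p.1, p.2.1, p.2.2) >>).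

End FreeModules.

(* The structure maps of a braided bialgebra with underlying module
   {malg k[A]}; the axioms are not part of the record. *)
Record bialg_data (k : fieldType) (A : choiceType) := BialgData {
  bmul : {malg k[(A * A)%type]} -> {malg k[A]};
  bone : {malg k[A]};
  bdelta : {malg k[A]} -> {malg k[(A * A)%type]};
  beps : {malg k[A]} -> k;
  bbraid : {malg k[(A * A)%type]} -> {malg k[(A * A)%type]}
}.

Section BraidedBialgebras.

Variables (k : fieldType) (A : choiceType).

Definition opcop (R : bialg_data k A) : bialg_data k A :=
  {| bmul := fun z => bmul R (flip z);
     bone := bone R;
     bdelta := fun a => flip (bdelta R a);
     beps := beps R;
     bbraid := fun z => flip (bbraid R (flip z)) |}.

Definition braided_bialg_iso (R R' : bialg_data k A)
    (f : {malg k[A]} -> {malg k[A]}) : Prop :=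
  [/\ linear f, bijective f,
      (forall z, f (bmul R z) = bmul R' (tmap f f z)) /\ f (bone R) = bone R',
      (forall a, tmap f f (bdelta R a) = bdelta R' (f a)) /\
        (forall a, beps R' (f a) = beps R a)
    & forall z, tmap f f (bbraid R z) = bbraid R' (tmap f f z)].

(* The subspace R (x) I + I (x) R. *)
Definition tens_ideal (I : {malg k[A]} -> Prop) (z : {malg k[(A * A)%type]}) :
    Prop :=
  exists2 s : seq ({malg k[A]} * {malg k[A]}),
    (forall p, p \in s -> I p.1 \/ I p.2) & z = \sum_(p <- s) tens p.1 p.2.

Definition subspace (I : {malg k[A]} -> Prop) : Prop :=
  [/\ I 0, forall a b, I a -> I b -> I (a + b)
    & forall (x : k) a, I a -> I (x *: a)].

Definition ideal (R : bialg_data k A) (I : {malg k[A]} -> Prop) : Prop :=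
  subspace I /\
  (forall a b, I b -> I (bmul R (tens a b)) /\ I (bmul R (tens b a))).

Definition coideal (R : bialg_data k A) (I : {malg k[A]} -> Prop) : Prop :=
  [/\ subspace I, forall a, I a -> tens_ideal I (bdelta R a)
    & forall a, I a -> beps R a = 0].

Definition braided_biideal (R : bialg_data k A) (I : {malg k[A]} -> Prop) :
    Prop :=
  [/\ ideal R I, coideal R I
    & forall z, tens_ideal I z <-> exists2 y, tens_ideal I y & bbraid R y = z].

End BraidedBialgebras.

(* V is the vector space {malg k[X]} with basis X, and V (x) V is
   {malg k[X * X]}. *)
Section Braidings.

Variables (k : fieldType) (d : Order.disp_t) (X : finOrderType d).
Implicit Types (c : {malg k[(X * X)%type]} -> {malg k[(X * X)%type]}).

Definition braid_left c :
    {malg k[(X * X * X)%type]} -> {malg k[(X * X * X)%type]} :=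
  tmap c id.

Definition braid_right c :
    {malg k[(X * X * X)%type]} -> {malg k[(X * X * X)%type]} :=
  fun z => assocl (tmap id c (assocr z)).

Definition braid_equation c : Prop :=
  forall z, braid_left c (braid_right c (braid_left c z))
          = braid_right c (braid_left c (braid_right c z)).

Definition right_triangular c : Prop :=
  exists (beta : X -> X -> k) (w : X -> X -> X -> {malg k[X]}),
    forall x y, c << (x, y) >> =
      beta x y *: << (y, x) >>
      + \sum_(z : X | (x < z)%O) tens (w x y z) << z >>.

End Braidings.

Section TensorAlgebra.

Variables (k : fieldType) (d : Order.disp_t) (X : finOrderType d).
Implicit Types (c : {malg k[(X * X)%type]} -> {malg k[(X * X)%type]}).

Local Notation word := {fmonom X}.
(* T(V) = k<X>, with concatenation as product; its subspace V^(x)n is spanned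
   by the words of length n. *)
Local Notation T := {malg k[{fmonom X}]}.
Local Notation TT := {malg k[({fmonom X} * {fmonom X})%type]}.

(* For f and g defined on V^(x)n and V^(x)m, the map f (x) g on V^(x)(n+m). *)
Definition wtens (n : nat) (f g : T -> T) : T -> T :=
  lext (fun w : word => f << FMonom (take n w) >> * g << FMonom (drop n w) >>).

(* The embedding of V (x) V in T(V), and c as a map on V^(x)2, extended by
   zero to the other degrees. *)
Definition emb2 : {malg k[(X * X)%type]} -> T :=
  lext (fun p : X * X => << FMonom [:: p.1; p.2] >>).

Definition braid2 c : T -> T :=
  lext (fun w : word =>
    if fmonom_val w is [:: x; y] then emb2 (c << (x, y) >>) else 0).

(* braid1 c m is c_{1,m} and braidnm c n m is c_{n,m}; both are meaningful on
   V^(x)(1+m) and V^(x)(n+m) only. *)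
Fixpoint braid1 c (m : nat) : T -> T :=
  if m is m'.+1 then fun a => wtens 1 id (braid1 c m') (wtens 2 (braid2 c) id a)
  else id.

Fixpoint braidnm c (n m : nat) : T -> T :=
  if n is n'.+1 then
    fun a => wtens (n' + m) (braidnm c n' m) id (wtens n' id (braid1 c m) a)
  else id.

Definition tsplit (m : nat) : T -> TT :=
  lext (fun w : word => << (FMonom (take m w), FMonom (drop m w)) >>).

Definition tbraid c : TT -> TT :=
  lext (fun p : word * word =>
    tsplit (size p.2) (braidnm c (size p.1) (size p.2) << mmul p.1 p.2 >>)).

Definition tmul : TT -> T := lext (fun p : word * word => << p.1 >> * << p.2 >>).

(* The product (m (x) m)(id (x) c (x) id) of the braided tensor square. *)
Definition braided_prod c (z z' : TT) : TT :=
  lext (fun p : word * word =>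
    lext (fun q : word * word =>
      lext (fun r : word * word =>
              tens (<< p.1 >> * << r.1 >>) (<< r.2 >> * << q.2 >>))
           (tbraid c << (p.2, q.1) >>)) z') z.

Definition tdelta c : T -> TT :=
  lext (fun w : word =>
    foldr (fun x z => braided_prod c (tens << fmu x >> 1 + tens 1 << fmu x >>) z)
          (tens 1 1) (fmonom_val w)).

Definition tensor_bialg c : bialg_data k word :=
  {| bmul := tmul; bone := 1; bdelta := tdelta c;
     beps := fun a => a@_(@mone word); bbraid := tbraid c |}.

Definition phi : T -> T := lext (fun w : word => << FMonom (rev w) >>).

Definition phi_image (I : T -> Prop) (b : T) : Prop :=
  exists2 a, I a & phi a = b.

Definition lex_lt (u v : word) : bool :=
  @Order.lt _ (seqlexi X) (fmonom_val u) (fmonom_val v).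

Definition lex_le (u v : word) : bool :=
  @Order.le _ (seqlexi X) (fmonom_val u) (fmonom_val v).

Definition lyndon (u : word) : Prop :=
  u <> mone /\
  forall v w : word, v <> mone -> w <> mone -> u = mmul v w -> lex_lt u w.

(* The standard order: shorter words are greater. *)
Definition std_ge (u v : word) : bool :=
  (size u < size v)%N || ((size u == size v) && lex_le v u).

Definition std_gt (u v : word) : bool := (u != v) && std_ge u v.

(* a lies in the sum of J and the span of the words greater than u. *)
Definition reducible (J : T -> Prop) (u : word) (a : T) : Prop :=
  exists p q : T,
    [/\ forall w, w \in msupp p -> std_gt w u, J q & a = p + q].

Definition pbw_words (J : T -> Prop) (u : word) : Prop :=
  lyndon u /\ ~ reducible J u << u >>.

Definition wpow (u : word) (t : nat) : word := iter t (mmul u) mone.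

(* h is the height h_J(u), None standing for infinity. *)
Definition is_height (J : T -> Prop) (u : word) (h : option nat) : Prop :=
  let P t := reducible J (wpow u t) << wpow u t >> in
  if h is Some t then P t /\ (forall t', P t' -> (t <= t')%N)
  else forall t, ~ P t.

Definition strict_total_order_on (S : T -> Prop) (lt : rel T) : Prop :=
  [/\ forall s, S s -> ~~ lt s s,
      forall s t u, S s -> S t -> S u -> lt s t -> lt t u -> lt s u
    & forall s t, S s -> S t -> s <> t -> lt s t \/ lt t s].

Definition below_height (e : nat) (h : option nat) : bool :=
  if h is Some t then (e < t)%N else true.

(* The PBW set generated by (S, lt) and h; a product s_1^e_1 ... s_t^e_t is
   given by the list of the pairs (s_i, e_i). *)
Definition pbw_set (S : T -> Prop) (lt : rel T) (h : T -> option nat) (a : T) :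
    Prop :=
  exists s : seq (T * nat),
    [/\ forall p, p \in s -> [/\ S p.1, (0 < p.2)%N & below_height p.2 (h p.1)],
        sorted (fun p q => lt q.1 p.1) s
      & a = \prod_(p <- s) p.1 ^+ p.2].

(* The images of the elements of B form a basis of the quotient of T(V) by the
   subspace I: distinct elements of B have linearly independent images, which
   span the quotient. *)
Definition basis_mod (I : T -> Prop) (B : T -> Prop) : Prop :=
  (forall (s : seq T) (x : T -> k), uniq s -> (forall b, b \in s -> B b) ->
     I (\sum_(b <- s) x b *: b) -> forall b, b \in s -> x b = 0) /\
  (forall a : T, exists (s : seq T) (x : T -> k),
     (forall b, b \in s -> B b) /\ I (a - \sum_(b <- s) x b *: b)).

End TensorAlgebra.

(* Main.v *)
Require Import Defs.
From HB Require Import structures.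
From mathcomp Require Import all_boot all_order all_algebra.
From mathcomp Require Import finmap.
From mathcomp.multinomials Require Import monalg.
From mathcomp Require Import ring.
From Stdlib Require Import ClassicalEpsilon.

Set Implicit Arguments.
Unset Strict Implicit.
Unset Printing Implicit Defensive.

Import Order.TTheory GRing.Theory.
Local Open Scope ring_scope.

(* Reversing words turns the right triangular braiding c into the left
   triangular one tau c tau, for which a letter can only grow when it moves to
   the left, its coefficient being nonzero when it does not grow.  Let J be the
   image of I.  Call a word u normal if u is not in k<X>_{> u} + J; the normal
   words form a basis modulo J and are closed under factors, so it suffices to
   show that a word is normal if its Lyndon factorization u1^e1 ... ut^et has
   normal blocks ui^ei.

   A Lyndon word u = vw with v, w Lyndon gets a bracket
   [u] = [v][w] - g^-1 [w][v], where g is the diagonal coefficient of c on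
   w (x) v.  Then [u] = u + (greater words) and
   Delta [u] = [u] (x) 1 + 1 (x) [u] + (words exceeding u strictly) (x) T.
   Given a nontrivial relation modulo J between products of brackets indexed by
   the words with normal blocks, let u be the least Lyndon factor occurring in
   top degree, e its largest exponent and v u^e the least word with u^e as its
   last block.  The component of Delta(relation) on u^e (x) v, read off modulo
   J in both factors, is a nonzero multiple of the coefficient of v u^e; but J
   is a coideal, so it vanishes.  Neither the braid equation nor the
   c-stability of I plays a role. *)

(** A crossing gives control of one tensor factor only: the word that moves left stays or grows at
    its first changed letter, while nothing is known of the word that moves right. So every support
    statement about coproducts concerns left factors, compared by an order, [dlt], that survives
    appending. In Delta ([v][w]) the term [v] (x) [w] resists, because v is a prefix of vw; Delta
    ([w][v]) contains it g times, up to admissible terms, and this dictates the coefficient g^-1. In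
    Delta ([u]^e) the terms with left word u^i, 0 < i < e, carry coefficients of quantum binomial
    type, which may vanish. The extreme component u^e (x) 1 has coefficient 1, so reading off u^e
    avoids them; the price is that the whole block u^e must be known to be normal. J need not be
    homogeneous, so a relation has terms of lower degree. These are invisible: in a pair of words of
    smaller total length one member is shorter, hence greater in the standard order, than its target
    u^e or v, and its normal form then has no such component. Normality of v itself comes from
    induction on the length. *)

(* Sealed copies of lext, << _ >> and tens: unification must not unfold the
   underlying finite sums. *)
HB.lock Definition linext (k : fieldType) (A : choiceType) (V : lmodType k)
  (f : A -> V) (z : {malg k[A]}) : V := lext f z.

HB.lock Definition gen (k : fieldType) (A : choiceType) (a : A) : {malg k[A]} :=
  << a >>.
Arguments gen {k A} a.

HB.lock Definition tensor (k : fieldType) (A B : choiceType)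
  (a : {malg k[A]}) (b : {malg k[B]}) : {malg k[(A * B)%type]} := tens a b.

(** * Linear extension, supports and tensors in free modules *)

Section LinearExtension.

Variable k : fieldType.
Implicit Types (A B C : choiceType) (V W : lmodType k).

Lemma genE A (a : A) : << a >> = gen a :> {malg k[A]}.
Proof. by rewrite [@gen]unlock. Qed.

Lemma msupp_gen A (a : A) : msupp (gen a : {malg k[A]}) = [fset a]%fset.
Proof. by rewrite -genE msuppU oner_eq0. Qed.

Lemma mcoeff_gen A (a b : A) : (gen a : {malg k[A]})@_b = (a == b)%:R.
Proof. by rewrite -genE mcoeffU. Qed.

Lemma lextE A V (f : A -> V) z : lext f z = linext f z.
Proof. by rewrite [@linext]unlock. Qed.

Lemma linextE A V (f : A -> V) z :
  linext f z = \sum_(a <- msupp z) z@_a *: f a.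
Proof. by rewrite -lextE. Qed.

Lemma linextEw A V (f : A -> V) (z : {malg k[A]}) (D : {fset A}) :
  (msupp z `<=` D)%fset -> linext f z = \sum_(a <- D) z@_a *: f a.
Proof.
move=> zD; rewrite linextE; apply: big_fset_incl => // a _.
by move/mcoeff_outdom=> ->; rewrite scale0r.
Qed.

Lemma linext_is_linear A V (f : A -> V) : linear (linext f).
Proof.
move=> x a b; pose D := (msupp (x *: a + b) `|` msupp a `|` msupp b)%fset.
rewrite !(@linextEw _ _ f _ D) ?scaler_sumr -?big_split /=.
- by apply: eq_bigr => i _; rewrite mcoeffD mcoeffZ scalerDl scalerA.
- by apply/fsubsetP=> i ib; rewrite !in_fsetU ib orbT.
- by apply/fsubsetP=> i ia; rewrite !in_fsetU ia orbT.
- by apply/fsubsetP=> i iab; rewrite !in_fsetU iab.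
Qed.

HB.instance Definition _ A V (f : A -> V) :=
  GRing.isLinear.Build k {malg k[A]} V *:%R (linext f) (linext_is_linear f).

Lemma linextU A V (f : A -> V) a : linext f (gen a) = f a.
Proof. by rewrite linextE msupp_gen big_seq_fset1 mcoeff_gen eqxx scale1r. Qed.

Lemma malgUZ A (x : k) (a : A) : << x *g a >> = x *: gen a.
Proof. by apply/malgP=> b; rewrite mcoeffZ mcoeff_gen mcoeffU mulr_natr. Qed.

Lemma malg_sum A (z : {malg k[A]}) :
  z = \sum_(a <- msupp z) z@_a *: gen a.
Proof. by rewrite {1}[z]monalgE; apply: eq_bigr => a _; rewrite malgUZ. Qed.

Lemma linext_id A (z : {malg k[A]}) : linext (fun a => gen a) z = z.
Proof. by rewrite [RHS]malg_sum linextE. Qed.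

Lemma linext_comp A V W (h : V -> W) (g : A -> V) z :
  linear h -> h (linext g z) = linext (fun a => h (g a)) z.
Proof.
move=> hL; pose H := GRing.isLinear.Build k V W *:%R h hL.
pose h' : {linear V -> W} := HB.pack h H.
rewrite -[h]/(h' : _ -> _) !linextE linear_sum; apply: eq_bigr => a _.
by rewrite linearZ.
Qed.

Lemma linear_malg A V (h : {malg k[A]} -> V) z :
  linear h -> h z = linext (fun a => h (gen a)) z.
Proof. by move=> hL; rewrite -(linext_comp _ _ hL) linext_id. Qed.

Lemma linext_linext A B V (f : B -> V) (g : A -> {malg k[B]}) z :
  linext f (linext g z) = linext (fun a => linext f (g a)) z.
Proof. exact/linext_comp/linext_is_linear. Qed.

Lemma eq_in_linext A V (f g : A -> V) (z : {malg k[A]}) :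
  (forall a, a \in msupp z -> f a = g a) -> linext f z = linext g z.
Proof. by move=> fg; rewrite !linextE; apply: eq_big_seq => a az; rewrite fg. Qed.

Lemma eq_linext A V (f g : A -> V) (z : {malg k[A]}) :
  f =1 g -> linext f z = linext g z.
Proof. by move=> fg; apply: eq_in_linext => a _. Qed.

Lemma linext_swap A B V (F : A -> B -> V) x y :
  linext (fun a => linext (F a) y) x = linext (fun b => linext (F^~ b) x) y.
Proof.
rewrite !linextE; under eq_bigr do rewrite linextE scaler_sumr.
rewrite exchange_big; apply: eq_bigr => b _; rewrite linextE scaler_sumr.
by apply: eq_bigr => a _; rewrite !scalerA mulrC.
Qed.

Lemma linextfD A V (f g : A -> V) z :
  linext (fun a => f a + g a) z = linext f z + linext g z.
Proof.
by rewrite !linextE -big_split; apply: eq_bigr => a _; rewrite scalerDr.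
Qed.

Lemma linextfZ A V (f : A -> V) (x : k) z :
  linext (fun a => x *: f a) z = x *: linext f z.
Proof.
by rewrite !linextE scaler_sumr; apply: eq_bigr => a _; rewrite !scalerA mulrC.
Qed.

(** A one-constructor type instead of a bare [forall]: it is a rigid head for unification, so
    [apply:] does not look through it to the membership hypothesis. *)
Variant supported A (P : A -> Prop) (z : {malg k[A]}) : Prop :=
  Supported of forall a, a \in msupp z -> P a.

Lemma supportedP A (P : A -> Prop) (z : {malg k[A]}) a :
  supported P z -> a \in msupp z -> P a.
Proof. by case=> Pz /Pz. Qed.

Lemma supported_gen A (P : A -> Prop) a : P a -> supported P (gen a).
Proof. by move=> Pa; split=> b; rewrite msupp_gen inE => /eqP->. Qed.

Lemma supported0 A (P : A -> Prop) : supported P 0.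
Proof. by split=> b; rewrite msupp0 inE. Qed.

Lemma supportedD A (P : A -> Prop) x y :
  supported P x -> supported P y -> supported P (x + y).
Proof.
move=> [Px] [Py]; split=> a /(fsubsetP (msuppD_le _ _)); rewrite inE.
by case/orP => [/Px|/Py].
Qed.

Lemma supportedZ A (P : A -> Prop) (x : k) z :
  supported P z -> supported P (x *: z).
Proof. by case=> Pz; split=> a /(fsubsetP (msuppZ_le _ _)) /Pz. Qed.

Lemma supportedN A (P : A -> Prop) z : supported P z -> supported P (- z).
Proof. by case=> Pz; split=> a; rewrite msuppN => /Pz. Qed.

Lemma supportedB A (P : A -> Prop) x y :
  supported P x -> supported P y -> supported P (x - y).
Proof. by move=> Px Py; apply: supportedD => //; apply: supportedN. Qed.

Lemma supported_sum A (P : A -> Prop) (I : eqType) (s : seq I) F :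
  (forall i, i \in s -> supported P (F i)) -> supported P (\sum_(i <- s) F i).
Proof.
move=> PF; rewrite big_seq.
by apply: big_ind => //; [exact: supported0 | exact: supportedD].
Qed.

Lemma supportedW A (P Q : A -> Prop) z :
  supported P z -> (forall a, P a -> Q a) -> supported Q z.
Proof. by move=> [Pz] PQ; split=> a /Pz/PQ. Qed.

Lemma supported_linext A B (P : A -> Prop) (Q : B -> Prop)
    (f : A -> {malg k[B]}) z :
  supported P z -> (forall a, P a -> supported Q (f a)) ->
  supported Q (linext f z).
Proof.
move=> [Pz] Qf; rewrite linextE; apply: (@supported_sum B Q A) => a /Pz Pa.
by apply: supportedZ; apply: Qf.
Qed.

Lemma linext_supp A V (P : A -> Prop) (f g : A -> V) z :
  supported P z -> (forall a, P a -> f a = g a) -> linext f z = linext g z.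
Proof. by move=> [Pz] fg; apply: eq_in_linext => a /Pz/fg. Qed.

Lemma supported_and A (P Q : A -> Prop) (z : {malg k[A]}) :
  supported P z -> supported Q z -> supported (fun a => P a /\ Q a) z.
Proof. by move=> [Pz] [Qz]; split=> a az; split; [exact: Pz | exact: Qz]. Qed.

Lemma supported_coef0 A (P : A -> Prop) z a :
  supported P z -> ~ P a -> z@_a = 0.
Proof. by move=> [Pz] nPa; apply: mcoeff_outdom; apply/negP => /Pz. Qed.

Lemma tens_tensor A B (a : {malg k[A]}) (b : {malg k[B]}) :
  tens a b = tensor a b.
Proof. by rewrite [@tensor]unlock. Qed.

Lemma tensorE A B (a : {malg k[A]}) (b : {malg k[B]}) :
  tensor a b = linext (fun i => linext (fun j => gen (i, j)) b) a.
Proof.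
rewrite -tens_tensor linextE; apply: eq_bigr => i _.
rewrite linextE scaler_sumr; apply: eq_bigr => j _.
by rewrite malgUZ scalerA.
Qed.

Lemma tensorEr A B (a : {malg k[A]}) (b : {malg k[B]}) :
  tensor a b = linext (fun j => linext (fun i => gen (i, j)) a) b.
Proof. by rewrite tensorE linext_swap. Qed.

Lemma tensorUU A B (a : A) (b : B) : tensor (gen a) (gen b) = gen (a, b) :> {malg k[_]}.
Proof. by rewrite tensorE !linextU. Qed.

Lemma tensor_linear_l A B (b : {malg k[B]}) :
  linear (fun a : {malg k[A]} => tensor a b).
Proof. by move=> x a a'; rewrite !tensorE linearP. Qed.

Lemma tensor_linear_r A B (a : {malg k[A]}) :
  linear (fun b : {malg k[B]} => tensor a b).
Proof. by move=> x b b'; rewrite !tensorEr linearP. Qed.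

Lemma mcoeff_tensor A B (a : {malg k[A]}) (b : {malg k[B]}) i j :
  (tensor a b)@_(i, j) = a@_i * b@_j.
Proof.
rewrite -tens_tensor /tens raddf_sum /=.
under eq_bigr => i' _.
  rewrite raddf_sum /=.
  under eq_bigr do rewrite mcoeffU -pair_eqE /= mulrb.
  over.
have E (C : choiceType) (z : {malg k[C]}) l :
    \sum_(l' <- msupp z) (if l' == l then z@_l' else 0) = z@_l.
  rewrite [in RHS](monalgE z) raddf_sum /=; apply: eq_bigr => l' _.
  by rewrite mcoeffU mulrb.
rewrite -[in RHS](E _ a) -[in RHS](E _ b) mulr_suml; apply: eq_bigr => i' _.
rewrite mulr_sumr; apply: eq_bigr => j' _.
by case: (i' == i); case: (j' == j); rewrite ?mul0r ?mulr0.
Qed.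

Lemma tmapE A B A' B' (f : {malg k[A]} -> {malg k[A']})
    (g : {malg k[B]} -> {malg k[B']}) z :
  tmap f g z = linext (fun p => tensor (f (gen p.1)) (g (gen p.2))) z.
Proof. by rewrite /tmap lextE; apply: eq_linext => p; rewrite !genE tens_tensor. Qed.

Lemma tmap_tensor A B A' B' (f : {malg k[A]} -> {malg k[A']})
    (g : {malg k[B]} -> {malg k[B']}) a b :
  linear f -> linear g -> tmap f g (tensor a b) = tensor (f a) (g b).
Proof.
move=> fL gL; rewrite (linear_malg a fL) (linear_malg b gL).
rewrite (linext_comp (fun i => f (gen i)) a (@tensor_linear_l A' B' _)).
rewrite tmapE tensorE linext_linext; apply: eq_linext => i.
rewrite (linext_comp (fun j => g (gen j)) b (@tensor_linear_r A' B' (f (gen i)))).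
by rewrite linext_linext; apply: eq_linext => j; rewrite linextU.
Qed.

Lemma flipE A B (z : {malg k[(A * B)%type]}) :
  flip z = linext (fun p => gen (p.2, p.1)) z.
Proof. by rewrite /flip lextE; apply: eq_linext => p; rewrite genE. Qed.

Lemma flipU A B (p : A * B) : flip (gen p) = gen (p.2, p.1) :> {malg k[_]}.
Proof. by rewrite flipE linextU. Qed.

Lemma flip_linear A B : linear (@flip k A B).
Proof. by move=> x a b; rewrite !flipE linearP. Qed.

Lemma flipK A B (z : {malg k[(A * B)%type]}) : flip (flip z) = z.
Proof.
rewrite !flipE linext_linext -[RHS]linext_id; apply: eq_linext => -[a b].
by rewrite linextU.
Qed.

Lemma flip_tensor A B (a : {malg k[A]}) (b : {malg k[B]}) :
  flip (tensor a b) = tensor b a.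
Proof.
rewrite !tensorE flipE linext_linext [RHS]linext_swap; apply: eq_linext => i.
by rewrite linext_linext; apply: eq_linext => j; rewrite linextU.
Qed.

End LinearExtension.

(** * The braided tensor square of the free algebra *)

Section FreeAlgebra.

Variables (k : fieldType) (X : choiceType).
Local Notation word := {fmonom X}.
Local Notation T := {malg k[{fmonom X}]}.

Lemma mmulE (v w : word) : mmul v w = FMonom (v ++ w).
Proof. by rewrite /mmul /= fmmulE. Qed.

Lemma moneE : mone = FMonom [::] :> word.
Proof. by rewrite /mone /= fmoneE. Qed.

Lemma malg1E : 1 = gen (FMonom [::]) :> T.
Proof. by rewrite -moneE -genE. Qed.

Lemma malgMUU (v w : word) : gen v * gen w = gen (FMonom (v ++ w)) :> T.
Proof. by rewrite -!genE -mmulE malgM_def fgmulUU mulr1. Qed.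

Lemma malgMlinext (a b : T) :
  a * b = linext (fun v : word => linext (fun w : word => gen (FMonom (v ++ w))) b) a.
Proof.
rewrite malgME linextE; apply: eq_bigr => v _; rewrite linextE scaler_sumr.
by apply: eq_bigr => w _; rewrite malgUZ scalerA mmulE.
Qed.

Lemma malgMl_linear (b : T) : linear (fun a : T => a * b).
Proof. by move=> x a a'; rewrite !malgMlinext linearP. Qed.

Lemma malgMr_linear (a : T) : linear (fun b : T => a * b).
Proof.
have E b : a * b = linext (fun w : word => linext (fun v : word => gen (FMonom (v ++ w))) a) b
  by rewrite malgMlinext linext_swap.
by move=> x b b'; rewrite !E linearP.
Qed.

Lemma linextMl (A : choiceType) (f : A -> T) z b :
  linext f z * b = linext (fun i => f i * b) z.
Proof. exact: (linext_comp f z (malgMl_linear b)). Qed.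

Lemma linextMr (A : choiceType) (f : A -> T) z b :
  b * linext f z = linext (fun i => b * f i) z.
Proof. exact: (linext_comp f z (malgMr_linear b)). Qed.

End FreeAlgebra.

(** * Crossing two words: the braiding of T(V) *)

Section Crossing.

Variables (k : fieldType) (d : Order.disp_t) (X : finOrderType d).
Variable c : {malg k[(X * X)%type]} -> {malg k[(X * X)%type]}.

Local Notation word := {fmonom X}.
Local Notation T := {malg k[{fmonom X}]}.
Local Notation TT := {malg k[({fmonom X} * {fmonom X})%type]}.

(** This is c_{1,n} applied to [x] and a word of length n, with values kept as pairs (word, letter
    that has moved right); no word has to be cut at a prescribed length. *)
Fixpoint cross1 (x : X) (t : seq X) : {malg k[({fmonom X} * X)%type]} :=
  if t is y :: t' then
    linext (fun r : X * X =>
      linext (fun q : word * X => gen (FMonom (r.1 :: q.1), q.2)) (cross1 r.2 t'))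
      (c (gen (x, y)))
  else gen (FMonom [::], x).

Fixpoint cross (s t : seq X) : TT :=
  if s is x :: s' then
    linext (fun q : word * word =>
      linext (fun r : word * X => gen (r.1, FMonom (r.2 :: q.2))) (cross1 x q.1))
      (cross s' t)
  else gen (FMonom t, FMonom [::]).

Lemma cross1_cat x s t :
  cross1 x (s ++ t) =
  linext (fun q : word * X =>
    linext (fun r : word * X => gen (FMonom (q.1 ++ r.1), r.2))
         (cross1 q.2 t)) (cross1 x s).
Proof.
elim: s x => [|y s IHs] x /=.
  rewrite linextU -[LHS]linext_id; apply: eq_linext => -[w z] /=.
  by rewrite fmK.
rewrite linext_linext; apply: eq_linext => r; rewrite IHs !linext_linext.
apply: eq_linext => q; rewrite linextU !linext_linext.
by apply: eq_linext => p; rewrite linextU.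
Qed.

Lemma cross_catl s s' t :
  cross (s ++ s') t =
  linext (fun q : word * word =>
    linext (fun r : word * word => gen (r.1, FMonom (r.2 ++ q.2)))
         (cross s q.1)) (cross s' t).
Proof.
elim: s => [|x s IHs] /=.
  by rewrite -[LHS]linext_id; apply: eq_linext => -[a b] /=; rewrite linextU /= !fmK.
rewrite IHs linext_linext; apply: eq_linext => q; rewrite !linext_linext.
apply: eq_linext => p; rewrite linextU !linext_linext.
by apply: eq_linext => r; rewrite linextU.
Qed.

(** Together with [cross_catl], the hexagon identities of the braiding on T(V). *)
Lemma cross_catr s t t' :
  cross s (t ++ t') =
  linext (fun q : word * word =>
    linext (fun r : word * word => gen (FMonom (q.1 ++ r.1), r.2))
         (cross q.2 t')) (cross s t).
Proof.
elim: s => [|x s IHs] /=; first by rewrite !linextU.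
rewrite IHs !linext_linext; apply: eq_linext => q; rewrite !linext_linext.
under eq_linext => r.
  rewrite linextU /= cross1_cat linext_linext.
  under eq_linext do rewrite linext_linext.
  over.
(* Moving [x] past [q.1] and moving [q.2] past [t'] involve disjoint strands, hence commute. *)
rewrite linext_swap; apply: eq_linext => r.
rewrite linextU /= linext_linext; apply: eq_linext => p.
rewrite linext_linext; apply: eq_linext => p'.
by rewrite !linextU.
Qed.

Lemma cross_nilr s : cross s [::] = gen (FMonom [::], FMonom s).
Proof. by elim: s => [|x s IHs] //=; rewrite IHs !linextU. Qed.

Lemma cross1_size x t :
  supported (fun q : word * X => size q.1 = size t) (cross1 x t).
Proof.
elim: t x => [|y t IHt] x /=; first exact: supported_gen.
apply: (supported_linext (P := fun=> True)) => // r _.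
apply: (supported_linext (IHt _)) => q /= sq.
by apply: supported_gen; rewrite /= sq.
Qed.

Lemma cross_size s t :
  supported (fun q : word * word => size q.1 = size t /\ size q.2 = size s)
    (cross s t).
Proof.
elim: s => [|x s IHs] /=; first exact: supported_gen.
apply: (supported_linext IHs) => q [q1 q2].
apply: (supported_linext (cross1_size _ _)) => r r1.
by apply: supported_gen; rewrite /= r1 q1 q2.
Qed.

Lemma cross_seq1 x t :
  cross [:: x] t = linext (fun r : word * X => gen (r.1, FMonom [:: r.2])) (cross1 x t).
Proof. by rewrite /= linextU. Qed.

Lemma wtensE n (f g : T -> T) a :
  wtens n f g a = linext (fun w : word =>
    f (gen (FMonom (take n w))) * g (gen (FMonom (drop n w)))) a.
Proof. by rewrite /wtens lextE; apply: eq_linext => w; rewrite !genE. Qed.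

Lemma braid2E x y :
  braid2 c (gen (FMonom [:: x; y])) =
  linext (fun r => gen (FMonom [:: r.1; r.2])) (c (gen (x, y))).
Proof.
rewrite /braid2 lextE linextU /= /emb2 lextE genE.
by apply: eq_linext => r; rewrite genE.
Qed.

Lemma wtensU n (f g : T -> T) (s t : seq X) : size s = n ->
  wtens n f g (gen (FMonom (s ++ t))) = f (gen (FMonom s)) * g (gen (FMonom t)).
Proof. by move=> sn; rewrite wtensE linextU take_size_cat ?drop_size_cat. Qed.

Lemma braid1E m x t : size t = m ->
  braid1 c m (gen (FMonom (x :: t))) =
  linext (fun q : word * X => gen (FMonom (q.1 ++ [:: q.2]))) (cross1 x t).
Proof.
elim: m x t => [|m IHm] x [|y t] //= => [_|[st]]; first by rewrite linextU.
rewrite (@wtensU 2 _ _ [:: x; y] t) // braid2E.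
rewrite linextMl wtensE !linext_linext; apply: eq_linext => r.
rewrite malgMUU linextU /= IHm // linextMr linext_linext.
by apply: eq_linext => q; rewrite malgMUU linextU.
Qed.

(** [braidnm] peels off the last letter of [s] and [cross] the first one; both perform the same
    crossings, and [cross_catl] reconciles the two recursions. *)
Lemma braidnmE n m s t : size s = n -> size t = m ->
  braidnm c n m (gen (FMonom (s ++ t))) =
  linext (fun q : word * word => gen (FMonom (q.1 ++ q.2))) (cross s t).
Proof.
elim: n s t => [|n IHn] s t; first by case: s => // _ _; rewrite /= linextU /= cats0.
case/lastP: s => // s x; rewrite size_rcons => -[ss] st /=.
rewrite cat_rcons wtensU // braid1E // linextMr.
rewrite -cats1 cross_catl cross_seq1 wtensE !linext_linext.
apply: (linext_supp (cross1_size x t)) => q q1.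
rewrite malgMUU !linextU /= catA.
have sq : size (s ++ q.1) = (n + m)%N by rewrite size_cat ss q1 st.
rewrite take_size_cat // drop_size_cat // IHn ?q1 // linextMl linext_linext.
by apply: eq_linext => r; rewrite malgMUU linextU /= catA.
Qed.

Lemma tsplitE m (a : T) :
  tsplit m a =
  linext (fun w : word => gen (FMonom (take m w), FMonom (drop m w))) a.
Proof. by rewrite /tsplit lextE; apply: eq_linext => w; rewrite genE. Qed.

Lemma tbraidE (p : word * word) : tbraid c (gen p) = cross p.1 p.2.
Proof.
rewrite /tbraid lextE linextU mmulE genE braidnmE // tsplitE linext_linext -[RHS]linext_id.
apply: (linext_supp (cross_size p.1 p.2)) => q [q1 _].
by rewrite linextU /= -q1 take_size_cat // drop_size_cat // !fmK; case: q {q1}.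
Qed.

End Crossing.

(** * The braided product and the coproduct as an algebra morphism *)

HB.lock Definition bprod (k : fieldType) (d : Order.disp_t) (X : finOrderType d)
    (c : {malg k[(X * X)%type]} -> {malg k[(X * X)%type]})
    (z z' : {malg k[({fmonom X} * {fmonom X})%type]}) :
    {malg k[({fmonom X} * {fmonom X})%type]} :=
  linext (fun p : {fmonom X} * {fmonom X} =>
    linext (fun q : {fmonom X} * {fmonom X} =>
      linext (fun r : {fmonom X} * {fmonom X} =>
                gen (FMonom (p.1 ++ r.1), FMonom (r.2 ++ q.2)))
             (cross c p.2 q.1)) z') z.

HB.lock Definition coprod (k : fieldType) (d : Order.disp_t)
    (X : finOrderType d)
    (c : {malg k[(X * X)%type]} -> {malg k[(X * X)%type]})
    (a : {malg k[{fmonom X}]}) : {malg k[({fmonom X} * {fmonom X})%type]} :=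
  linext (fun w : {fmonom X} =>
    foldr (fun x => bprod c (gen (FMonom [:: x], FMonom [::])
                             + gen (FMonom [::], FMonom [:: x])))
          (gen (FMonom [::], FMonom [::])) (fmonom_val w)) a.

Section Coproduct.

Variables (k : fieldType) (d : Order.disp_t) (X : finOrderType d).
Variable c : {malg k[(X * X)%type]} -> {malg k[(X * X)%type]}.

Local Notation word := {fmonom X}.
Local Notation T := {malg k[{fmonom X}]}.
Local Notation TT := {malg k[({fmonom X} * {fmonom X})%type]}.

Lemma bprodE (z z' : TT) :
  bprod c z z' =
  linext (fun p : word * word => linext (fun q : word * word =>
    linext (fun r : word * word =>
              gen (FMonom (p.1 ++ r.1), FMonom (r.2 ++ q.2)))
           (cross c p.2 q.1)) z') z.
Proof. by rewrite [@bprod]unlock. Qed.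

Lemma braided_prodE (z z' : TT) : braided_prod c z z' = bprod c z z'.
Proof.
rewrite bprodE /braided_prod lextE; apply: eq_linext => p.
rewrite lextE; apply: eq_linext => q; rewrite lextE genE tbraidE.
by apply: eq_linext => r; rewrite !genE !malgMUU tens_tensor tensorUU.
Qed.

Lemma bprod_linear_l z' : linear (fun z => bprod c z z').
Proof. by move=> x a b; rewrite !bprodE linearP. Qed.

Lemma bprod_linear_r z : linear (fun z' => bprod c z z').
Proof. by move=> x a b; rewrite !bprodE ![linext _ z]linext_swap linearP. Qed.

Lemma bprod_gen (p q : word * word) :
  bprod c (gen p) (gen q) =
  linext (fun r : word * word =>
            gen (FMonom (p.1 ++ r.1), FMonom (r.2 ++ q.2))) (cross c p.2 q.1).
Proof. by rewrite bprodE !linextU. Qed.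

(** Both bracketings make the same crossings: the right word of [a] passes the left words of [b] and
    [e], and the right word of [b] passes the left word of [e]. The hexagon identities split the
    composite crossings, and disjoint ones are swapped. *)
Lemma bprodA : associative (bprod c).
Proof.
move=> a b e; rewrite !bprodE linext_linext; apply: eq_linext => p.
rewrite !linext_linext; apply: eq_linext => q; rewrite !linext_linext.
under [RHS]eq_linext => r.
  rewrite linextU.
  under eq_linext => t.
    rewrite cross_catl linext_linext.
    under eq_linext do rewrite linext_linext.
    over.
  over.
rewrite [RHS]linext_swap; apply: eq_linext => t; rewrite linext_linext.
rewrite [RHS]linext_swap; apply: eq_linext => u; rewrite linextU.
rewrite cross_catr linext_linext; apply: eq_linext => v; rewrite linext_linext.
by apply: eq_linext => w; rewrite !linextU /= !catA.
Qed.

Lemma tens11 : tens 1 1 = gen (FMonom [::], FMonom [::]) :> TT.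
Proof. by rewrite !malg1E tens_tensor tensorUU. Qed.

Lemma bprod1l z : bprod c (gen (FMonom [::], FMonom [::])) z = z.
Proof.
rewrite bprodE linextU -[RHS]linext_id; apply: eq_linext => -[a b] /=.
by rewrite linextU /= !fmK.
Qed.

Lemma bprod1r z : bprod c z (gen (FMonom [::], FMonom [::])) = z.
Proof.
rewrite bprodE -[RHS]linext_id; apply: eq_linext => -[a b] /=.
by rewrite linextU /= cross_nilr linextU /= !cats0 !fmK.
Qed.

Definition primitive (x : X) : TT :=
  gen (FMonom [:: x], FMonom [::]) + gen (FMonom [::], FMonom [:: x]).

Lemma coprodE (a : T) :
  coprod c a = linext (fun w : word =>
    foldr (fun x => bprod c (primitive x)) (gen (FMonom [::], FMonom [::]))
          (fmonom_val w)) a.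
Proof. by rewrite [@coprod]unlock. Qed.

Lemma tdeltaE a : tdelta c a = coprod c a.
Proof.
rewrite coprodE /tdelta lextE; apply: eq_linext => w.
elim: (fmonom_val w) => [|x s IHs] /=; first by rewrite tens11.
by rewrite IHs braided_prodE fmuE malg1E genE !tens_tensor !tensorUU.
Qed.

Lemma coprod_nil : coprod c (gen (FMonom [::])) = gen (FMonom [::], FMonom [::]).
Proof. by rewrite coprodE linextU. Qed.

Lemma coprod_cons x s :
  coprod c (gen (FMonom (x :: s))) =
  bprod c (primitive x) (coprod c (gen (FMonom s))).
Proof. by rewrite !coprodE !linextU. Qed.

Lemma coprod_cat s t :
  coprod c (gen (FMonom (s ++ t))) =
  bprod c (coprod c (gen (FMonom s))) (coprod c (gen (FMonom t))).
Proof.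
elim: s => [|x s IHs]; first by rewrite coprod_nil bprod1l.
by rewrite cat_cons !coprod_cons IHs bprodA.
Qed.

Lemma coprod_linear : linear (coprod c).
Proof. by move=> x a b; rewrite !coprodE linearP. Qed.

Lemma coprodM a b : coprod c (a * b) = bprod c (coprod c a) (coprod c b).
Proof.
rewrite malgMlinext (linext_comp _ _ coprod_linear).
rewrite [coprod c a](linear_malg a coprod_linear).
rewrite (linext_comp _ _ (bprod_linear_l _)); apply: eq_linext => v.
rewrite (linext_comp _ _ coprod_linear) [coprod c b](linear_malg b coprod_linear).
rewrite (linext_comp _ _ (bprod_linear_r _)); apply: eq_linext => w.
by rewrite coprod_cat !fmK.
Qed.

End Coproduct.

(** * Reversal of words *)

Section Reversal.

Variables (k : fieldType) (d : Order.disp_t) (X : finOrderType d).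
Variable c : {malg k[(X * X)%type]} -> {malg k[(X * X)%type]}.

Local Notation word := {fmonom X}.
Local Notation T := {malg k[{fmonom X}]}.
Local Notation TT := {malg k[({fmonom X} * {fmonom X})%type]}.
Variable c' : {malg k[(X * X)%type]} -> {malg k[(X * X)%type]}.
Hypothesis c'E : forall x y,
  c' (gen (y, x)) = linext (fun r : X * X => gen (r.2, r.1)) (c (gen (x, y))).
Local Notation phi := (@phi k d X).

Definition revw (w : word) : word := FMonom (rev w).

Lemma revwK : involutive revw.
Proof. by case=> s; rewrite /revw /= revK. Qed.

Lemma phiE (a : T) : phi a = linext (fun w : word => gen (revw w)) a.
Proof. by rewrite /Defs.phi lextE; apply: eq_linext => w; rewrite genE. Qed.

Lemma phi_gen w : phi (gen w) = gen (revw w).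
Proof. by rewrite phiE linextU. Qed.

Lemma phi_linear : linear phi.
Proof. by move=> x a b; rewrite !phiE linearP. Qed.

Lemma phiK : involutive phi.
Proof.
move=> a; rewrite !phiE linext_linext -[RHS]linext_id; apply: eq_linext => w.
by rewrite linextU revwK.
Qed.

Lemma mcoeff_phi a w : (phi a)@_w = a@_(revw w).
Proof.
rewrite [in RHS](malg_sum a) phiE linextE !raddf_sum /=.
apply: eq_bigr => v _; rewrite !mcoeffZ !mcoeff_gen.
by rewrite -[w in LHS]revwK (inj_eq (can_inj revwK)).
Qed.

Lemma phi1 : phi 1 = 1.
Proof. by rewrite malg1E phi_gen. Qed.

Lemma phiM a b : phi (a * b) = phi b * phi a.
Proof.
rewrite malgMlinext (linext_comp _ _ phi_linear) (phiE a) linextMr.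
apply: eq_linext => v; rewrite (linext_comp _ _ phi_linear) (phiE b) linextMl.
by apply: eq_linext => w; rewrite phi_gen malgMUU /revw /= rev_cat.
Qed.

Lemma phiX a n : phi (a ^+ n) = phi a ^+ n.
Proof.
by elim: n => [|n IHn]; rewrite ?phi1 // exprS phiM IHn -exprSr.
Qed.

Lemma flip_tmap_phi (z : TT) :
  flip (tmap phi phi z) =
  linext (fun p : word * word => gen (revw p.2, revw p.1)) z.
Proof.
rewrite tmapE flipE linext_linext; apply: eq_linext => p.
by rewrite !phi_gen tensorUU linextU.
Qed.

Lemma cross_rev1 x t :
  cross c' (rev t) [:: x] =
  linext (fun q : word * X => gen (FMonom [:: q.2], FMonom (rev q.1)))
         (cross1 c x t).
Proof.
elim: t x => [|y t IHt] x; first by rewrite /= linextU.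
rewrite rev_cons -cats1 cross_catl cross_seq1 /= c'E.
rewrite !linext_linext; apply: eq_linext => r.
rewrite !linextU /= IHt !linext_linext; apply: eq_linext => q.
by rewrite !linextU /= rev_cons -cats1.
Qed.

(** Seen in a mirror, each elementary crossing [c] becomes [c'] and the two words trade places. *)
Lemma cross_rev s t :
  cross c' (rev t) (rev s) =
  linext (fun q : word * word => gen (revw q.2, revw q.1)) (cross c s t).
Proof.
elim: s => [|x s IHs] /=; first by rewrite cross_nilr linextU.
rewrite rev_cons -cats1 cross_catr IHs !linext_linext; apply: eq_linext => q.
rewrite linextU cross_rev1 !linext_linext; apply: eq_linext => r.
by rewrite !linextU /revw /= rev_cons -cats1.
Qed.

Definition revtens (z : TT) : TT :=
  linext (fun p : word * word => gen (revw p.2, revw p.1)) z.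

Lemma revtens_linear : linear revtens.
Proof. exact: linext_is_linear. Qed.

Lemma revtens_bprod z z' :
  revtens (bprod c z z') = bprod c' (revtens z') (revtens z).
Proof.
rewrite /revtens !bprodE [RHS]linext_swap !linext_linext.
apply: eq_linext => p; rewrite linextU !linext_linext; apply: eq_linext => q.
rewrite !linextU /= cross_rev !linext_linext; apply: eq_linext => r.
by rewrite !linextU /revw /= !rev_cat.
Qed.

(** [revtens] reverses products and fixes the primitive elements of letters, so a letter put in
    front on one side is appended on the other. *)
Lemma revtens_coprod_gen s :
  revtens (coprod c (gen (FMonom s))) = coprod c' (gen (FMonom (rev s))).
Proof.
elim: s => [|x s IHs].
  by rewrite !coprod_nil /revtens linextU.
rewrite rev_cons -cats1 coprod_cat !coprod_cons coprod_nil bprod1r.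
rewrite revtens_bprod IHs; congr bprod.
by rewrite /revtens /primitive linearD /= !linextU /= addrC.
Qed.

Lemma revtens_coprod a : revtens (coprod c a) = coprod c' (phi a).
Proof.
rewrite (linear_malg a (@coprod_linear _ _ _ c)) (linext_comp _ _ revtens_linear).
rewrite phiE (linext_comp _ _ (@coprod_linear _ _ _ _)); apply: eq_linext => w.
by rewrite -[w in LHS]fmK revtens_coprod_gen.
Qed.

Lemma revtens_cross (z : TT) :
  revtens (linext (fun p : word * word => cross c p.1 p.2) z) =
  linext (fun p : word * word => cross c' p.1 p.2) (revtens z).
Proof.
rewrite /revtens !linext_linext.
by apply: eq_linext => p; rewrite linextU cross_rev.
Qed.

Lemma tbraid_cross (z : TT) :
  tbraid c z = linext (fun p : word * word => cross c p.1 p.2) z.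
Proof.
rewrite {1}/tbraid lextE; apply: eq_linext => p.
by rewrite -tbraidE /tbraid lextE linextU.
Qed.

End Reversal.

Lemma flip_braidingE (k : fieldType) (d : Order.disp_t) (X : finOrderType d)
    (c : {malg k[(X * X)%type]} -> {malg k[(X * X)%type]}) x y :
  flip (c (flip (gen (y, x)))) =
  linext (fun r : X * X => gen (r.2, r.1)) (c (gen (x, y))).
Proof. by rewrite flipU flipE. Qed.

Lemma phi_iso (k : fieldType) (d : Order.disp_t) (X : finOrderType d)
    (c : {malg k[(X * X)%type]} -> {malg k[(X * X)%type]}) :
  braided_bialg_iso (tensor_bialg c)
    (opcop (tensor_bialg (fun z => flip (c (flip z))))) (@phi k d X).
Proof.
pose c' z := flip (c (flip z)).
have c'E x y : c' (gen (y, x)) =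
    linext (fun r : X * X => gen (r.2, r.1)) (c (gen (x, y))).
  exact: flip_braidingE.
(* From here on only the values of [c'] on basis elements matter. *)
rewrite -/c'; move: c' c'E => c' c'E; split=> /=; first exact: phi_linear.
- by exists (@phi k d X); apply: phiK.
- split=> [z|]; last exact: phi1.
  rewrite /tmul !lextE flip_tmap_phi (linext_comp _ _ (@phi_linear _ _ _)).
  rewrite linext_linext; apply: eq_linext => p.
  by rewrite linextU !genE phiM !phi_gen.
- split=> a; last by rewrite mcoeff_phi moneE.
  rewrite !tdeltaE -(revtens_coprod c'E) -[LHS]flipK; congr flip.
  exact: flip_tmap_phi.
- move=> z; rewrite (tbraid_cross c) (tbraid_cross c') flip_tmap_phi.
  by rewrite -/(revtens z) -(revtens_cross c'E) /revtens -flip_tmap_phi flipK.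
Qed.

(** * Lyndon words *)

Section LyndonWords.

Variables (d : Order.disp_t) (X : orderType d).
Implicit Types (p q r s t u v w l : seq X) (ls : seq (seq X)).

Definition slt s t : bool := @Order.lt _ (seqlexi X) s t.

Lemma slt_trans : transitive slt.
Proof. exact: (@lt_trans _ (seqlexi X)). Qed.

Lemma sltxx s : slt s s = false.
Proof. exact: (@ltxx _ (seqlexi X)). Qed.

Lemma slt_total s t : [|| slt s t, s == t | slt t s].
Proof. by rewrite /slt; case: (@ltgtP _ (seqlexi X)) => //= ->; rewrite eqxx. Qed.

Lemma sltNge s t : ~~ slt s t -> s != t -> slt t s.
Proof. by move/negbTE=> st /negbTE st'; have := slt_total s t; rewrite st st'. Qed.

(** The lexicographic order restricted to pairs decided by a differing letter, so that neither word
    is a prefix of the other. Unlike the full order it persists when arbitrary words are appended on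
    both sides. *)
Fixpoint dlt p q : bool :=
  if p is a :: p' then
    if q is b :: q' then (a < b)%O || (a == b) && dlt p' q' else false
  else false.

Lemma sltE s t : slt s t = dlt s t || prefix s t && (s != t).
Proof.
rewrite /slt; elim: s t => [|a s IHs] [|b t] //=.
rewrite ltxi_cons IHs eqseq_cons.
by case: ltgtP => //= _; rewrite ?andbF ?andbT.
Qed.

Lemma dlt_slt s t : dlt s t -> slt s t.
Proof. by rewrite sltE => ->. Qed.

Lemma dlt_cat p q s t : dlt p q -> dlt (p ++ s) (q ++ t).
Proof.
elim: p q => [|a p IHp] [|b q] //= /orP[-> //|/andP[-> /IHp->]].
by rewrite orbT.
Qed.

Lemma dlt_catr p q t : dlt p q -> dlt p (q ++ t).
Proof. by move/(dlt_cat [::] t); rewrite cats0. Qed.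

Lemma dlt_catl r p q : dlt (r ++ p) (r ++ q) = dlt p q.
Proof. by elim: r => //= a r ->; rewrite ltxx eqxx. Qed.

Lemma dltxx p : dlt p p = false.
Proof. by elim: p => //= a p ->; rewrite ltxx andbF. Qed.

Lemma dlt_trans : transitive dlt.
Proof.
move=> q p r; elim: q p r => [|b q IHq] [|a p] [|e r] //=.
case/orP=> [ab|/andP[/eqP-> pq]] /orP[be|/andP[/eqP<- qr]].
- by rewrite (lt_trans ab be).
- by rewrite ab.
- by rewrite be.
- by rewrite eqxx (IHq _ _ pq qr) orbT.
Qed.

Lemma slt_dlt s t : slt s t -> (size t <= size s)%N -> dlt s t.
Proof.
rewrite sltE => /orP[//|/andP[/prefixP[r ->]]].
move=> sr; rewrite size_cat -{2}[size s]addn0 leq_add2l leqn0 size_eq0 => /eqP r0.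
by move: sr; rewrite r0 cats0 eqxx.
Qed.

Lemma dlt_trunc q r p : dlt (q ++ r) p -> (size p <= size q)%N -> dlt q p.
Proof.
elim: q p => [|a q IHq] [|b p] //=; first by case: r.
by move=> /orP[-> //|/andP[-> /IHq qp]] /qp ->; rewrite orbT.
Qed.

Definition lyn u : Prop :=
  u != [::] /\
  forall v w, v != [::] -> w != [::] -> u = v ++ w -> slt u w.

Lemma lyn_letter x : lyn [:: x].
Proof. by split=> // -[|y [|? ?]] // [|z w]. Qed.

(** A proper suffix is shorter than [u], so [u] is not a prefix of it and the comparison must be
    decided at a letter. *)
Lemma lyn_suffix u v w : lyn u -> u = v ++ w -> v != [::] -> w != [::] ->
  dlt u w.
Proof.
move=> [_ uL] uE v0 w0; apply: slt_dlt; first exact: (uL v w).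
by rewrite uE size_cat leq_addl.
Qed.

(** The critical case is v = u t: there t is a proper suffix of the Lyndon word v, so v < t at a
    letter, and prefixing both sides with u gives the claim. *)
Lemma lyn_cat_dlt u v : lyn v -> u != [::] -> slt u v -> dlt (u ++ v) v.
Proof.
move=> vL u0; rewrite sltE => /orP[uv|/andP[/prefixP[t vE]]].
  by rewrite -{2}[v]cats0; apply: dlt_cat.
move=> uv; rewrite {2}vE dlt_catl; apply: (lyn_suffix vL vE) => //.
by apply: contraNneq uv => t0; rewrite vE t0 cats0.
Qed.

Lemma cat_eq_cat u v a b : u ++ v = a ++ b ->
  (exists a', a = u ++ a' /\ v = a' ++ b) \/
  (exists b', [/\ b' != [::], u = a ++ b' & b = b' ++ v]).
Proof.
elim: u a => [|x u IHu] [|y a] //=.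
- by move=> ->; left; exists [::].
- by move=> ->; left; exists (y :: a).
- by move=> <-; right; exists (x :: u).
case=> <- /IHu[[a' [-> ->]]|[b' [b0 -> ->]]].
  by left; exists a'.
by right; exists b'.
Qed.

Lemma lyn_cat u v : lyn u -> lyn v -> slt u v -> lyn (u ++ v).
Proof.
move=> uL vL uv; split; first by case: u uL {uv} => [[]|].
have uvv := lyn_cat_dlt vL uL.1 uv.
move=> a b a0 b0 /cat_eq_cat[[a' [aE vE]]|[b' [b'0 uE ->]]]; apply: dlt_slt.
  have [a'0|a'0] := eqVneq a' [::]; first by move: vE; rewrite a'0 /= => <-.
  exact/(dlt_trans uvv)/(lyn_suffix vL vE).
exact/dlt_cat/(lyn_suffix uL uE).
Qed.

Lemma seq_min (T : eqType) (le : rel T) (s : seq T) :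
  total le -> transitive le -> s != [::] ->
  exists2 m, m \in s & {in s, forall x, le m x}.
Proof.
move=> leT ler s0; case E: (sort le s) => [|m t].
  by move: s0; rewrite -size_eq0 -(size_sort le) E.
exists m => [|x]; first by rewrite -(mem_sort le) E mem_head.
have := sort_sorted leT s; rewrite E /= => /(order_path_min ler)/allP mt.
rewrite -(mem_sort le) E inE => /orP[/eqP->|/mt //].
by have := leT m m; rewrite orbb.
Qed.

(** Take for [w] the least proper nonempty suffix of [u]; its suffixes are suffixes of [u], so it is
    Lyndon. If [v] had a proper suffix b <= v, then u < b w forces v = b t, and cancelling b gives t
    w < w, against minimality. *)
Lemma lyn_decomp u : lyn u -> (1 < size u)%N ->
  exists v w, [/\ lyn v, lyn w & u = v ++ w].
Proof.
move=> uL u1; have u0 : (0 < size u)%N by apply: ltnW.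
pose sle (s t : seq X) := @Order.le _ (seqlexi X) s t.
have sleE s t : sle s t = ~~ slt t s by rewrite /sle leNgt.
pose suf := [seq drop i u | i <- iota 1 (size u).-1].
have sufP a b : u = a ++ b -> a != [::] -> b != [::] -> b \in suf.
  move=> uE a0 b0; apply/mapP; exists (size a); last by rewrite uE drop_size_cat.
  rewrite mem_iota lt0n size_eq0 a0 add1n prednK ?uE ?size_cat; last first.
    by rewrite addn_gt0 lt0n size_eq0 a0.
  by rewrite -[X in (X < _)%N]addn0 ltn_add2l lt0n size_eq0.
have [] := @seq_min _ sle suf (@le_total _ (seqlexi X)) (@le_trans _ (seqlexi X)).
  by rewrite -size_eq0 size_map size_iota -lt0n -ltnS prednK.
move=> w /mapP[i]; rewrite mem_iota add1n prednK // => /andP[i0 iu] wE wmin.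
have uE : u = take i u ++ w by rewrite wE cat_take_drop.
have v0 : take i u != [::] by rewrite -size_eq0 size_take iu -lt0n.
have w0 : w != [::] by rewrite wE -size_eq0 size_drop subn_eq0 -ltnNge.
move: (take i u) uE v0 => v uE v0 {i i0 iu wE}.
exists v, w; split=> //; split=> // a b a0 b0 abE.
  have bw0 : b ++ w != [::] by case: (b) b0.
  have uE' : u = a ++ (b ++ w) by rewrite uE abE catA.
  have := lyn_suffix uL uE' a0 bw0; rewrite uE => vwbw.
  apply/negPn/negP => vb.
  have vneb : v != b.
    apply: contraNneq a0 => vb'; have /eqP := congr1 size abE.
    by rewrite vb' size_cat -{1}[size b]add0n eqn_add2r eq_sym size_eq0.
  have := sltNge vb vneb; rewrite sltE => /orP[bv|].
    by have := dlt_trans vwbw (dlt_cat w w bv); rewrite dltxx.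
  case/andP=> /prefixP[t vE] bv.
  have := wmin (t ++ w); rewrite sleE (sufP b) //.
  - move=> /(_ isT) /negP; apply; apply: dlt_slt.
    by rewrite -(dlt_catl b) catA -vE.
  - by rewrite uE vE catA.
  - by case: (t) bv vE => // bv vE; rewrite vE cats0 eqxx in bv.
have := wmin b; rewrite sleE (sufP (v ++ a)) ?uE ?abE ?catA //; last by case: (v) v0.
move=> /(_ isT)/sltNge; apply.
apply: contraNneq a0; rewrite -size_eq0 => /(congr1 size)/eqP.
by rewrite size_cat -{1}[size b]add0n eqn_add2r eq_sym.
Qed.

Definition noninc ls : bool := sorted (fun v w => ~~ slt v w) ls.

(** As long as [u] is smaller than the next factor, the two merge into a single Lyndon word by
    [lyn_cat], which is inserted in turn. *)
Lemma lyn_insert u ls : lyn u -> noninc ls -> (forall l, l \in ls -> lyn l) ->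
  exists ls', [/\ noninc ls', forall l, l \in ls' -> lyn l
                & flatten ls' = u ++ flatten ls].
Proof.
elim: ls u => [|l ls IHls] u uL lsS lsL.
  by exists [:: u]; split=> // l; rewrite inE => /eqP->.
have [ul|ul] := boolP (slt u l); last first.
  exists (u :: l :: ls); split=> //; first by rewrite /noninc /= ul.
  by move=> v; rewrite inE => /orP[/eqP-> //|]; apply: lsL.
have ulL : lyn (u ++ l) by apply: lyn_cat => //; apply: lsL; rewrite mem_head.
have [||ls' [S' L' E']] := IHls _ ulL.
- by move: lsS; rewrite /noninc /=; apply: path_sorted.
- by move=> v vls; apply: lsL; rewrite inE vls orbT.
by exists ls'; split; rewrite // E' /= catA.
Qed.

Lemma lyn_factorization w :
  exists ls, [/\ noninc ls, forall l, l \in ls -> lyn l & flatten ls = w].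
Proof.
elim: w => [|x w [ls [lsS lsL <-]]]; first by exists [::].
exact: lyn_insert (lyn_letter x) lsS lsL.
Qed.

Definition pw u e : seq X := flatten (nseq e u).

Lemma pwS u e : pw u e.+1 = u ++ pw u e. Proof. by []. Qed.

Lemma pwD u e f : pw u (e + f) = pw u e ++ pw u f.
Proof. by rewrite /pw nseqD flatten_cat. Qed.

Lemma size_pw u e : size (pw u e) = (e * size u)%N.
Proof. by elim: e => // e IHe; rewrite pwS size_cat IHe mulSn. Qed.

(* [above u p]: p exceeds the infinite word uuu... at their first
   difference. *)
Definition above u p : Prop := exists e, dlt (pw u e) p.

Lemma above_cat u p t : above u p -> above u (p ++ t).
Proof. by case=> e up; exists e; apply: dlt_catr. Qed.

Lemma above_pw_cat u i p : above u p -> above u (pw u i ++ p).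
Proof. by case=> e up; exists (i + e)%N; rewrite pwD dlt_catl. Qed.

Lemma above_dlt u p q : above u p -> dlt p q -> above u q.
Proof. by case=> e up pq; exists e; apply: dlt_trans pq. Qed.

Lemma dlt_pw_above u i p : dlt (pw u i) p -> above u p.
Proof. by exists i. Qed.

Lemma dlt_above u p : dlt u p -> above u p.
Proof. by exists 1%N; rewrite pwS cats0. Qed.

(** If [l] merely continues [u], say l = u t', then t' is a proper suffix of [l], so t' > l > u and
    the comparison restarts with t'. This is why [H] treats all suffixes of [l] that are greater
    than [u]. *)
Lemma lyn_above u l : u != [::] -> lyn l -> slt u l -> above u l.
Proof.
move=> u0 lL ul.
have H n t r : (size t <= n)%N -> l = r ++ t -> slt u t -> above u t.
  elim: n t r => [|n IHn] t r tn lE ut.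
    move: tn ut; rewrite leqn0 size_eq0 => /eqP->.
    by rewrite sltE; case: (u) => [|? ?]; rewrite ?eqxx.
  move: (ut); rewrite sltE => /orP[/dlt_above //|/andP[/prefixP[t' tE]]].
  move=> ut'; rewrite tE; have := @above_pw_cat u 1 t'; rewrite pwS cats0.
  apply.
  have t0 : t' != [::] by apply: contraNneq ut' => t0; rewrite tE t0 cats0.
  apply: (IHn t' (r ++ u)).
  - rewrite -ltnS; apply: leq_trans tn; rewrite tE size_cat.
    by rewrite -{1}[size t']add0n ltn_add2r lt0n size_eq0.
  - by rewrite lE tE catA.
  apply: slt_trans ul _; apply: dlt_slt; apply: (@lyn_suffix _ (r ++ u)) => //.
  - by rewrite lE tE catA.
  - by case: (r) => //; case: (u) u0.
exact: (H (size l) l [::]).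
Qed.

Lemma lyn_dlt_above u l p :
  u != [::] -> lyn l -> slt u l -> dlt l p -> above u p.
Proof. by move=> u0 lL ul; apply: above_dlt; apply: lyn_above. Qed.

(** The first difference lies inside [p], hence inside any power of [u] at least as long as [p]. *)
Lemma above_size u p e : above u p -> (size p <= e * size u)%N ->
  dlt (pw u e) p.
Proof.
case=> f up pe; have [fe|ef] := leqP f e.
  by rewrite -(subnKC fe) pwD -[p]cats0; apply: dlt_cat.
move: up; rewrite -(subnKC (ltnW ef)) pwD => /dlt_trunc; apply.
by rewrite size_pw.
Qed.

End LyndonWords.

(** * Triangular braidings and supports *)

Section LinearFunctions.

Variables (k : fieldType) (V W : lmodType k) (f : V -> W).
Hypothesis fL : linear f.

Lemma linfD a b : f (a + b) = f a + f b.
Proof. by have := fL 1 a b; rewrite !scale1r. Qed.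

Lemma linf0 : f 0 = 0.
Proof. by apply: (addrI (f 0)); rewrite -linfD !addr0. Qed.

Lemma linfZ x a : f (x *: a) = x *: f a.
Proof. by have := fL x a 0; rewrite !addr0 linf0 addr0. Qed.

Lemma linfB a b : f (a - b) = f a - f b.
Proof. by rewrite linfD -[- b]scaleN1r linfZ scaleN1r. Qed.

End LinearFunctions.

Section LinearExtensionTheory.

Variables (k : fieldType) (A : choiceType) (V : lmodType k) (f : A -> V).

Lemma linextD a b : linext f (a + b) = linext f a + linext f b.
Proof. exact/linfD/linext_is_linear. Qed.

Lemma linextZ x a : linext f (x *: a) = x *: linext f a.
Proof. exact/linfZ/linext_is_linear. Qed.

End LinearExtensionTheory.

Section WordSupports.

Variables (k : fieldType) (X : choiceType).
Implicit Types (P Q R : seq X -> Prop).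

Local Notation word := {fmonom X}.
Local Notation T := {malg k[{fmonom X}]}.
Local Notation TT := {malg k[({fmonom X} * {fmonom X})%type]}.

Definition wsupp P (a : T) : Prop := supported (fun w : word => P w) a.

Definition lsupp P (z : TT) : Prop :=
  supported (fun p : word * word => P p.1) z.

Lemma wsupp_gen P s : P s -> wsupp P (gen (FMonom s)).
Proof. by move=> Ps; apply: supported_gen. Qed.

Lemma wsupp0 P : wsupp P 0.
Proof. exact: supported0. Qed.

Lemma wsuppD P a b : wsupp P a -> wsupp P b -> wsupp P (a + b).
Proof. exact: supportedD. Qed.

Lemma wsuppB P a b : wsupp P a -> wsupp P b -> wsupp P (a - b).
Proof. exact: supportedB. Qed.

Lemma wsuppZ P x a : wsupp P a -> wsupp P (x *: a).
Proof. exact: supportedZ. Qed.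

Lemma wsuppW P Q a : wsupp P a -> (forall s, P s -> Q s) -> wsupp Q a.
Proof. by move=> Pa PQ; apply: supportedW Pa _ => w; apply: PQ. Qed.

Lemma wsupp_mul P Q R a b :
  wsupp P a -> wsupp Q b -> (forall p q, P p -> Q q -> R (p ++ q)) ->
  wsupp R (a * b).
Proof.
move=> Pa Qb PQR; rewrite malgMlinext; apply: (supported_linext Pa) => v Pv.
apply: (supported_linext Qb) => w Qw.
by apply: supported_gen; apply: PQR.
Qed.

Lemma lsupp0 P : lsupp P 0.
Proof. exact: supported0. Qed.

Lemma lsuppD P y z : lsupp P y -> lsupp P z -> lsupp P (y + z).
Proof. exact: supportedD. Qed.

Lemma lsuppB P y z : lsupp P y -> lsupp P z -> lsupp P (y - z).
Proof. exact: supportedB. Qed.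

Lemma lsuppZ P x z : lsupp P z -> lsupp P (x *: z).
Proof. exact: supportedZ. Qed.

Lemma lsuppW P Q z : lsupp P z -> (forall s, P s -> Q s) -> lsupp Q z.
Proof. by move=> Pz PQ; apply: supportedW Pz _ => w; apply: PQ. Qed.

End WordSupports.

Section TriangularCrossing.

Variables (k : fieldType) (d : Order.disp_t) (X : finOrderType d).
Variable c : {malg k[(X * X)%type]} -> {malg k[(X * X)%type]}.
Variable g : X -> X -> k.

Local Notation word := {fmonom X}.
Local Notation T := {malg k[{fmonom X}]}.
Local Notation TT := {malg k[({fmonom X} * {fmonom X})%type]}.

Hypothesis c_tri : forall x y,
  supported (fun p : X * X => (y < p.1)%O)
            (c (gen (x, y)) - g x y *: gen (y, x)).

Definition gw (s t : seq X) : k := \prod_(x <- s) \prod_(y <- t) g x y.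

Lemma gw_perm s s' t : perm_eq s s' -> gw s t = gw s' t.
Proof. exact: perm_big. Qed.

(** The first letter that is raised decides the comparison, so nothing has to be known about the
    crossings that follow it; if none is raised, the diagonal coefficients multiply. *)
Lemma cross1_tri x t :
  supported (fun p : word * X => dlt t p.1)
            (cross1 c x t - (\prod_(y <- t) g x y) *: gen (FMonom t, x)).
Proof.
elim: t x => [|y t IHt] x /=.
  by rewrite big_nil scale1r subrr; apply: supported0.
rewrite -[c _](subrK (g x y *: gen (y, x))) linextD linextZ linextU /=.
rewrite -addrA; apply: supportedD.
  apply: (supported_linext (c_tri x y)) => p yp.
  apply: (supported_linext (P := fun => True)) => // q _.
  by apply: supported_gen; rewrite /= yp.
rewrite big_cons -scalerA -scalerBr; apply: supportedZ.
rewrite -[cross1 c x t](subrK ((\prod_(y <- t) g x y) *: gen (FMonom t, x))).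
rewrite linextD linextZ linextU /= addrK.
apply: (supported_linext (IHt x)) => p tp.
by apply: supported_gen; rewrite /= eqxx tp orbT.
Qed.

Lemma cross1_ge x t :
  supported (fun p : word * X => p.1 = t :> seq X \/ dlt t p.1) (cross1 c x t).
Proof.
rewrite -[cross1 c x t](subrK ((\prod_(y <- t) g x y) *: gen (FMonom t, x))).
apply: supportedD; last by apply/supportedZ/supported_gen; left.
by apply: supportedW (cross1_tri x t) _ => p; right.
Qed.

Lemma cross_tri s t :
  supported (fun p : word * word => dlt t p.1)
            (cross c s t - gw s t *: gen (FMonom t, FMonom s)).
Proof.
elim: s => [|x s IHs] /=.
  by rewrite /gw big_nil scale1r subrr; apply: supported0.
rewrite -[cross c s t](subrK (gw s t *: gen (FMonom t, FMonom s))).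
rewrite linextD linextZ linextU /= -addrA; apply: supportedD.
  apply: (supported_linext IHs) => p tp.
  apply: (supported_linext (cross1_ge x p.1)) => q qp; apply: supported_gen.
  by case: qp => [->|] //=; apply: dlt_trans.
rewrite /gw big_cons mulrC -scalerA -scalerBr; apply: supportedZ.
rewrite -[cross1 c x t](subrK ((\prod_(y <- t) g x y) *: gen (FMonom t, x))).
rewrite linextD linextZ linextU /= addrK.
by apply: (supported_linext (cross1_tri x t)) => p tp; apply: supported_gen.
Qed.

Lemma cross_ge s t :
  supported (fun p : word * word => p.1 = t :> seq X \/ dlt t p.1) (cross c s t).
Proof.
rewrite -[cross c s t](subrK (gw s t *: gen (FMonom t, FMonom s))).
apply: supportedD; last by apply/supportedZ/supported_gen; left.
by apply: supportedW (cross_tri s t) _ => p; right.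
Qed.

Lemma lsupp_tens (P : seq X -> Prop) (a b : T) :
  wsupp P a -> lsupp P (tensor a b).
Proof.
move=> Pa; rewrite tensorE; apply: (supported_linext Pa) => v Pv.
by apply: (supported_linext (P := fun=> True)) => // w _; apply: supported_gen.
Qed.

Lemma lsupp_bprod (P Q R : seq X -> Prop) (z z' : TT) :
  lsupp P z -> lsupp Q z' ->
  (forall p q r, P p -> Q q -> r = q \/ dlt q r -> R (p ++ r)) ->
  lsupp R (bprod c z z').
Proof.
move=> Pz Qz' PQR; rewrite bprodE; apply: (supported_linext Pz) => p Pp.
apply: (supported_linext Qz') => q Qq.
apply: (supported_linext (cross_ge p.2 q.1)) => r rq.
by apply: supported_gen; apply: PQR rq.
Qed.

Lemma bprod_tens1l (a b e : T) :
  bprod c (tensor a 1) (tensor b e) = tensor (a * b) e.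
Proof.
rewrite malgMlinext malg1E !tensorE bprodE !linext_linext; apply: eq_linext => v.
rewrite !linext_linext linextU !linextU linext_linext; apply: eq_linext => w.
rewrite !linext_linext linextU; apply: eq_linext => u.
by rewrite !linextU /= fmK.
Qed.

Lemma bprod_tens1r (a b e : T) :
  bprod c (tensor a b) (tensor 1 e) = tensor a (b * e).
Proof.
rewrite malgMlinext malg1E !tensorE bprodE !linext_linext linextU.
apply: eq_linext => v; rewrite !linext_linext; apply: eq_linext => w.
rewrite !linextU !linext_linext; apply: eq_linext => u.
by rewrite !linextU /= cross_nilr linextU /= cats0 fmK.
Qed.

(** The main term is a sum over the words of [b] because its weight depends on the word; it becomes
    a scalar multiple of a tensor once all these words are rearrangements of one another. *)
Lemma bprod_swap (a b : T) (s : seq X) :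
  wsupp (dlt s) (a - gen (FMonom s)) ->
  lsupp (dlt s)
    (bprod c (tensor 1 b) (tensor a 1)
     - linext (fun q : word => gw q s *: gen (FMonom s, q)) b).
Proof.
move=> aP; rewrite -{1}[a](subrK (gen (FMonom s))).
rewrite (linfD (@tensor_linear_l _ _ _ _)) (linfD (@bprod_linear_r _ _ _ _ _)).
rewrite -addrA; apply: lsuppD.
  apply: (@lsupp_bprod (fun p => p = [::]) (dlt s) (dlt s)).
  - by apply: lsupp_tens; rewrite malg1E; apply: wsupp_gen.
  - exact: lsupp_tens.
  - by move=> p q r -> sq [->|] //; apply: dlt_trans.
rewrite malg1E tensorUU tensorE linextU bprodE linext_linext.
rewrite -[X in _ - X]scale1r -scaleNr -linextfZ -linextfD.
apply: (supported_linext (P := fun=> True)) => // q _.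
rewrite !linextU /= scaleN1r.
under eq_linext => r do rewrite cats0 !fmK -surjective_pairing.
by rewrite linext_id; have := cross_tri q s; rewrite fmK.
Qed.

End TriangularCrossing.

(** * Brackets of Lyndon words *)

Section Brackets.

Variables (k : fieldType) (d : Order.disp_t) (X : finOrderType d).
Variable c : {malg k[(X * X)%type]} -> {malg k[(X * X)%type]}.
Variable g : X -> X -> k.

Local Notation word := {fmonom X}.
Local Notation T := {malg k[{fmonom X}]}.
Local Notation TT := {malg k[({fmonom X} * {fmonom X})%type]}.

Hypothesis c_tri : forall x y,
  supported (fun p : X * X => (y < p.1)%O)
            (c (gen (x, y)) - g x y *: gen (y, x)).
Hypothesis g_neq0 : forall x y, g x y != 0.

Lemma gw_neq0 s t : gw g s t != 0.
Proof.
rewrite /gw prodf_seq_neq0; apply/allP => x _ /=.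
by rewrite prodf_seq_neq0; apply/allP => y _ /=; apply: g_neq0.
Qed.

Definition lead (s : seq X) (a : T) : Prop :=
  wsupp (dlt s) (a - gen (FMonom s)).

Lemma lead_gen s : lead s (gen (FMonom s)).
Proof. by rewrite /lead subrr; apply: wsupp0. Qed.

Lemma lead_ge s a : lead s a ->
  wsupp (fun w => w = s \/ dlt s w) a.
Proof.
move=> sa; rewrite -[a](subrK (gen (FMonom s))); apply: wsuppD.
  by apply: wsuppW sa _; right.
by apply: wsupp_gen; left.
Qed.

Lemma lead_mul s t a b : lead s a -> lead t b -> lead (s ++ t) (a * b).
Proof.
move=> sa tb; rewrite /lead; have -> : a * b - gen (FMonom (s ++ t)) =
    (a - gen (FMonom s)) * b + gen (FMonom s) * (b - gen (FMonom t)).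
  by rewrite mulrBl mulrBr malgMUU addrA subrK.
apply: wsuppD.
  apply: (wsupp_mul sa (lead_ge tb)) => p q sp _; exact: dlt_cat.
have gs : wsupp (fun p => p = s) (gen (FMonom s) : T) by apply: wsupp_gen.
apply: (wsupp_mul gs tb) => p q -> tq.
by rewrite dlt_catl.
Qed.

Definition skew_primitive (P : seq X -> Prop) (a : T) : Prop :=
  lsupp P (coprod c a - (tensor a 1 + tensor 1 a)).

Lemma coprodM_expand a b :
  let ra := coprod c a - (tensor a 1 + tensor 1 a) in
  let rb := coprod c b - (tensor b 1 + tensor 1 b) in
  coprod c (a * b) =
    tensor (a * b) 1 + tensor a b + tensor 1 (a * b) + bprod c (tensor 1 a) (tensor b 1)
    + (bprod c ra (coprod c b) + bprod c (tensor a 1) rb + bprod c (tensor 1 a) rb).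
Proof.
move=> ra rb; rewrite coprodM.
have -> : coprod c a = ra + (tensor a 1 + tensor 1 a) by rewrite subrK.
have Eb : coprod c b = rb + (tensor b 1 + tensor 1 b) by rewrite subrK.
move: ra rb Eb => ra rb Eb; rewrite !(linfD (@bprod_linear_l _ _ _ _ _)).
have E z : bprod c z (coprod c b) =
    bprod c z rb + (bprod c z (tensor b 1) + bprod c z (tensor 1 b)).
  by rewrite -!(linfD (@bprod_linear_r _ _ _ _ _)) -Eb.
rewrite (E (tensor a 1)) (E (tensor 1 a)).
rewrite bprod_tens1l !bprod_tens1r !mul1r.
by apply/malgP => w; rewrite !mcoeffD; ring.
Qed.

Lemma lsupp_bprod_nil (P R : seq X -> Prop) (a : T) (z : TT) :
  lsupp P z -> (forall q r, P q -> r = q \/ dlt q r -> R r) ->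
  lsupp R (bprod c (tensor 1 a) z).
Proof.
move=> Pz PR.
apply: (@lsupp_bprod _ _ _ _ _ c_tri (fun p => p = [::]) P R).
- by apply: lsupp_tens; rewrite malg1E; apply: wsupp_gen.
- exact: Pz.
- by move=> p q r ->; apply: PR.
Qed.

Lemma lsupp_bprod_l (P R : seq X -> Prop) (z z' : TT) :
  lsupp P z -> (forall p r, P p -> R (p ++ r)) -> lsupp R (bprod c z z').
Proof.
move=> Pz PR.
apply: (@lsupp_bprod _ _ _ _ _ c_tri P (fun=> True) R) => //.
by move=> p q r /PR.
Qed.

Section LyndonProduct.

Variables (v w : seq X) (bv bw : T).
Hypotheses (uw : dlt (v ++ w) w) (bvl : lead v bv) (bwl : lead w bw).
Hypotheses (bvs : skew_primitive (dlt v) bv) (bws : skew_primitive (dlt w) bw).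

Let cancel3 (x y z : TT) : x + y + z - x = y + z.
Proof. by rewrite addrC -!addrA addKr. Qed.

(** By [uw], left words that start from [w] exceed [v ++ w], and so do those starting above [v].
    Apart from the two skew-primitive terms only bv (x) bw cannot be absorbed. *)
Lemma coprod_mul_lyn :
  lsupp (dlt (v ++ w))
    (coprod c (bv * bw)
     - (tensor (bv * bw) 1 + tensor bv bw + tensor 1 (bv * bw))).
Proof.
rewrite coprodM_expand cancel3.
apply: lsuppD; last apply: lsuppD; last 1 first.
- apply: (lsupp_bprod_nil _ bws) => q r wq rq; apply: dlt_trans uw _.
  by case: rq => [->|/(dlt_trans wq)].
- apply: (lsupp_bprod_nil _ (lsupp_tens _ (lead_ge bwl))) => q r wq rq.
  case: rq => [->|rq]; first by case: wq => [->|/(dlt_trans uw)].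
  by apply: dlt_trans rq; case: wq => [->|/(dlt_trans uw)].
apply: lsuppD; first by apply: (lsupp_bprod_l _ bvs) => p r; apply: dlt_cat.
apply: (lsupp_bprod c_tri (lsupp_tens _ (lead_ge bvl)) bws) => p q r vp wq rq.
have {q wq rq} wr : dlt w r by case: rq => [->|/(dlt_trans wq)].
by case: vp => [->|vp]; [rewrite dlt_catl | apply: dlt_cat].
Qed.

(** Here bw (x) bv is absorbed, its left words exceeding [v ++ w], while the crossing (1 (x) bw)(bv
    (x) 1) returns bv (x) bw. The support hypothesis on [bw] makes the weight of this crossing the
    constant [gw g w v]. *)
Lemma coprod_mul_lyn_rev :
  wsupp (perm_eq^~ w) bw ->
  lsupp (dlt (v ++ w))
    (coprod c (bw * bv)
     - (tensor (bw * bv) 1 + gw g w v *: tensor bv bw + tensor 1 (bw * bv))).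
Proof.
move=> bwp; pose s := gw g w v *: tensor bv bw.
have vuw p : dlt v p -> dlt (v ++ w) p.
  by move=> vp; rewrite -[p]cats0; apply: dlt_cat.
have uwp p : p = w \/ dlt w p -> dlt (v ++ w) p.
  by case=> [->|/(dlt_trans uw)].
have rearrange (D x y z t e : TT) :
    D - (x + t + z) = (D - (x + y + z + e)) + y + (e - t).
  by apply/malgP => i; rewrite !(mcoeffD, mcoeffN); ring.
rewrite (rearrange _ _ (tensor bw bv) _ _ (bprod c (tensor 1 bw) (tensor bv 1))).
apply: lsuppD; first apply: lsuppD.
- rewrite coprodM_expand [_ + _ - _]addrC addKr.
  apply: lsuppD; last first.
    apply: (lsupp_bprod_nil _ bvs) => q r vq rq; apply: vuw.
    by case: rq => [->|/(dlt_trans vq)].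
  apply: lsuppD.
    by apply: (lsupp_bprod_l _ bws) => p r wp; apply/dlt_catr/(dlt_trans uw).
  by apply: (lsupp_bprod_l _ (lsupp_tens _ (lead_ge bwl))) => p r /uwp/dlt_catr.
- by apply: lsuppW (lsupp_tens _ (lead_ge bwl)) _ => p /uwp.
have -> : bprod c (tensor 1 bw) (tensor bv 1) - s =
    (bprod c (tensor 1 bw) (tensor bv 1)
     - linext (fun q : word => gw g q v *: gen (FMonom v, q)) bw)
    - gw g w v *: tensor (bv - gen (FMonom v)) bw.
  have -> : linext (fun q : word => gw g q v *: gen (FMonom v, q)) bw =
      gw g w v *: tensor (gen (FMonom v)) bw.
    rewrite tensorE linextU -linextfZ; apply: (linext_supp bwp) => q qw.
    by rewrite (gw_perm g v qw).
  rewrite (linfB (@tensor_linear_l _ _ _ _)) /s; move: (bprod c _ _) => z.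
  by rewrite scalerBr opprB addrA subrK.
apply: lsuppB; last first.
  by apply/lsuppZ/(lsuppW (lsupp_tens _ bvl)) => p /vuw.
by apply: lsuppW (bprod_swap c_tri bw bvl) _ => p /vuw.
Qed.

End LyndonProduct.

(** The second property carries the recursion: it supplies the support hypothesis of
    [coprod_mul_lyn_rev]. The correction term does not disturb the leading word, as its words begin
    with [w] or more and so exceed [v ++ w]. *)
Lemma bracket_exists u : lyn u -> exists b,
  [/\ lead u b, wsupp (perm_eq^~ u) b
    & skew_primitive (dlt u) b].
Proof.
elim: {u}_.+1 {-2}u (ltnSn (size u)) => // n IHn u un uL.
have [u1|u1] := leqP (size u) 1.
  case: u uL u1 {un} => [|x [|//]] [] // _ _ _.
  exists (gen (FMonom [:: x])); split; first exact: lead_gen.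
    exact: wsupp_gen.
  rewrite /skew_primitive coprod_cons coprod_nil bprod1r /primitive malg1E.
  by rewrite !tensorUU subrr; apply: lsupp0.
have [v [w [vL wL uE]]] := lyn_decomp uL u1.
have [v0 w0] : (0 < size v)%N /\ (0 < size w)%N.
  by rewrite !lt0n !size_eq0; split; [case: vL | case: wL].
have [|bv [bvl bvp bvs]] := IHn v _ vL.
  by rewrite -ltnS; apply: leq_trans un; rewrite uE size_cat ltnS -addn1 leq_add2l.
have [|bw [bwl bwp bws]] := IHn w _ wL.
  by rewrite -ltnS; apply: leq_trans un; rewrite uE size_cat ltnS -add1n leq_add2r.
have uw : dlt (v ++ w) w.
  by rewrite -uE; apply: lyn_suffix uL uE _ _; [case: vL | case: wL].
have D1 := coprod_mul_lyn uw bvl bwl bvs bws.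
have D2 := coprod_mul_lyn_rev uw bvl bwl bvs bws bwp.
pose b := bv * bw - (gw g w v)^-1 *: (bw * bv).
exists b; rewrite uE; split.
- rewrite /lead /b addrAC; apply: wsuppB; first exact: lead_mul.
  apply: wsuppZ; apply: (wsupp_mul (lead_ge bwl) (lead_ge bvl)).
  by move=> p q wp _; apply: dlt_catr; case: wp => [->|/(dlt_trans uw)].
- apply: wsuppB.
    by apply: (wsupp_mul bvp bwp) => p q; apply: perm_cat.
  apply: wsuppZ; apply: (wsupp_mul bwp bvp) => p q pw qv.
  by rewrite perm_sym perm_catC; apply: perm_cat; rewrite perm_sym.
have := lsuppB D1 (lsuppZ (gw g w v)^-1 D2).
rewrite /skew_primitive /b.
rewrite (linfB (@coprod_linear _ _ _ _)) (linfZ (@coprod_linear _ _ _ _)).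
rewrite (linfB (@tensor_linear_l _ _ _ _)) (linfZ (@tensor_linear_l _ _ _ _)).
rewrite (linfB (@tensor_linear_r _ _ _ _)) (linfZ (@tensor_linear_r _ _ _ _)).
have rearrange (E1 E2 x1 x2 z1 z2 y : TT) (t : k) : t != 0 ->
    E1 - t^-1 *: E2 - (x1 - t^-1 *: x2 + (z1 - t^-1 *: z2)) =
    E1 - (x1 + y + z1) - t^-1 *: (E2 - (x2 + t *: y + z2)).
  move=> t0; rewrite scalerBr !scalerDr scalerA mulVf // scale1r.
  move: (_ *: E2) (_ *: x2) (_ *: z2) => {}E2 {}x2 {}z2.
  by apply/malgP => i; rewrite !(mcoeffD, mcoeffN); ring.
by rewrite (rearrange _ _ _ _ _ _ (tensor bv bw) _ (gw_neq0 _ _)).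
Qed.

End Brackets.

(** * Coproducts of products of brackets *)

Section BracketProducts.

Variables (k : fieldType) (d : Order.disp_t) (X : finOrderType d).
Variable c : {malg k[(X * X)%type]} -> {malg k[(X * X)%type]}.
Variable g : X -> X -> k.

Local Notation word := {fmonom X}.
Local Notation T := {malg k[{fmonom X}]}.
Local Notation TT := {malg k[({fmonom X} * {fmonom X})%type]}.

Hypothesis c_tri : forall x y,
  supported (fun p : X * X => (y < p.1)%O)
            (c (gen (x, y)) - g x y *: gen (y, x)).

Variable br : seq X -> T.
Hypothesis brP : forall u, lyn u ->
  [/\ lead u (br u), wsupp (perm_eq^~ u) (br u)
    & skew_primitive c (dlt u) (br u)].

Definition brprod (ls : seq (seq X)) : T := \prod_(l <- ls) br l.

Lemma brprod_lead ls : (forall l, l \in ls -> lyn l) ->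
  lead (flatten ls) (brprod ls).
Proof.
rewrite /brprod; elim: ls => [|l ls IHls] lsL.
  by rewrite big_nil malg1E; apply: lead_gen.
rewrite big_cons; apply: lead_mul.
  by have [] := brP (lsL l (mem_head _ _)).
by apply: IHls => l' l'ls; apply: lsL; rewrite inE l'ls orbT.
Qed.

Lemma brprod_perm ls : (forall l, l \in ls -> lyn l) ->
  wsupp (perm_eq^~ (flatten ls)) (brprod ls).
Proof.
rewrite /brprod; elim: ls => [|l ls IHls] lsL.
  by rewrite big_nil malg1E; apply: wsupp_gen.
rewrite big_cons; have [_ lP _] := brP (lsL l (mem_head _ _)).
apply: (wsupp_mul lP (IHls _)) => [l' l'ls|p q]; last exact: perm_cat.
by apply: lsL; rewrite inE l'ls orbT.
Qed.

Lemma coprod_size_gen s :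
  supported (fun p : word * word => (size p.1 + size p.2)%N = size s)
            (coprod c (gen (FMonom s))).
Proof.
elim: s => [|x s IHs]; first by rewrite coprod_nil; apply: supported_gen.
rewrite coprod_cons bprodE.
have Px : supported (fun p : word * word => (size p.1 + size p.2)%N = 1%N)
    (primitive k x).
  by apply: supportedD; apply: supported_gen.
apply: (supported_linext Px) => p p1.
apply: (supported_linext IHs) => q qs.
apply: (supported_linext (cross_size c p.2 q.1)) => r [r1 r2].
apply: supported_gen; rewrite /= !size_cat r1 r2.
by rewrite addnACA p1 qs add1n.
Qed.

Lemma coprod_size n a : wsupp (fun s => size s = n) a ->
  supported (fun p : word * word => (size p.1 + size p.2)%N = n) (coprod c a).
Proof.
move=> an; rewrite (linear_malg a (@coprod_linear _ _ _ c)).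
apply: (supported_linext an) => w <-.
by have := coprod_size_gen w; rewrite fmK.
Qed.

Section Above.

Variable u : seq X.
Hypothesis uL : lyn u.

Let u0 : u != [::]. Proof. by case: uL. Qed.

Lemma above_mul a b :
  lsupp (above u) (coprod c a - tensor 1 a) ->
  lsupp (above u) (coprod c b - tensor 1 b) ->
  lsupp (above u) (coprod c (a * b) - tensor 1 (a * b)).
Proof.
move=> aP bP; have -> : coprod c (a * b) - tensor 1 (a * b) =
    bprod c (coprod c a - tensor 1 a) (coprod c b)
    + bprod c (tensor 1 a) (coprod c b - tensor 1 b).
  rewrite coprodM (linfB (@bprod_linear_l _ _ _ _ _)).
  by rewrite (linfB (@bprod_linear_r _ _ _ _ _)) bprod_tens1r addrA subrK.
apply: lsuppD.
  by apply: (lsupp_bprod_l c_tri _ aP) => p r; apply: above_cat.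
apply: (lsupp_bprod_nil c_tri _ bP) => q r uq [->//|].
exact: above_dlt.
Qed.

(** A Lyndon word greater than [u] already exceeds uuu..., by [lyn_above], so the summand br l (x) 1
    is negligible as well and only 1 (x) br l is left. *)
Lemma brprod_above ls : (forall l, l \in ls -> lyn l /\ slt u l) ->
  lsupp (above u) (coprod c (brprod ls) - tensor 1 (brprod ls)).
Proof.
rewrite /brprod; elim: ls => [|l ls IHls] lsL.
  by rewrite big_nil {1}malg1E coprod_nil malg1E tensorUU subrr; apply: lsupp0.
rewrite big_cons; apply: above_mul; last first.
  by apply: IHls => l' l'ls; apply: lsL; rewrite inE l'ls orbT.
have [lL ul] := lsL l (mem_head _ _); have [ll _ ls'] := brP lL.
rewrite -[coprod c _](subrK (tensor (br l) 1 + tensor 1 (br l))) !addrA addrK.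
apply: lsuppD.
  by apply: lsuppW ls' _ => p; apply: lyn_dlt_above.
apply: lsuppW (lsupp_tens _ (lead_ge ll)) _ => p [->|].
  exact: lyn_above.
exact: lyn_dlt_above.
Qed.

(** The left words that are negligible beside u^e. The lower powers come from the middle terms of
    the expansion of Delta ([u]^e), whose coefficients need not be computed. *)
Definition low_or_above e p : Prop :=
  (exists2 i, (i < e)%N & p = pw u i) \/ above u p.

Lemma low_or_above_dlt e q r :
  low_or_above e q -> r = q \/ dlt q r -> low_or_above e r.
Proof.
move=> uq [->//|qr]; right; case: uq => [[i _ qE]|uq].
  by apply: (@dlt_pw_above _ _ _ i); rewrite -qE.
exact: above_dlt qr.
Qed.

Lemma coprod_br_exp e :
  lsupp (low_or_above e)
    (coprod c (br u ^+ e) - gen (FMonom (pw u e), FMonom [::])).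
Proof.
elim: e => [|e IHe].
  by rewrite expr0 malg1E coprod_nil subrr; apply: lsupp0.
have [ul _ us] := brP uL.
set B := br u ^+ e in IHe *; set P := gen _ in IHe.
have PS : gen (FMonom (pw u e.+1), FMonom [::]) =
    bprod c (tensor (gen (FMonom u)) 1) P :> TT.
  by rewrite malg1E tensorUU bprod_gen /= linextU.
(* Delta [u] is split into its remainder, ([u] - u) (x) 1, u (x) 1 and 1 (x) [u]. Only u (x) 1 times
   [P] yields u^(e+1); the factor 1 (x) [u] does not lengthen a power on the left, so it leaves
   exponents at most e. *)
have -> : coprod c (br u ^+ e.+1) - gen (FMonom (pw u e.+1), FMonom [::]) =
    bprod c (coprod c (br u) - (tensor (br u) 1 + tensor 1 (br u))) (coprod c B)
    + bprod c (tensor (br u - gen (FMonom u)) 1) (coprod c B)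
    + bprod c (tensor (gen (FMonom u)) 1) (coprod c B - P)
    + bprod c (tensor 1 (br u)) (coprod c B).
  rewrite exprS coprodM PS (linfB (@tensor_linear_l _ _ _ _)).
  rewrite !(linfB (@bprod_linear_l _ _ _ _ _)) (linfB (@bprod_linear_r _ _ _ _ _)).
  rewrite (linfD (@bprod_linear_l _ _ _ _ _)).
  move: (bprod c (coprod c _) _) (bprod c (tensor (br u) 1) _)
    (bprod c (tensor 1 _) _) (bprod c (tensor (gen _) 1) (coprod c B))
    (bprod c (tensor (gen _) 1) P) => x1 x2 x3 x4 x5.
  by apply/malgP => i; rewrite !(mcoeffD, mcoeffN); ring.
have low p r : above u p -> low_or_above e.+1 (p ++ r).
  by move=> up; right; apply: above_cat.
have lowS q r : low_or_above e q -> r = q \/ dlt q r ->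
    low_or_above e.+1 (u ++ r).
  move=> uq rq; have := low_or_above_dlt uq rq => -[[i ie ->]|ur].
    by left; exists i.+1.
  by right; have := @above_pw_cat _ _ u 1 _ ur; rewrite pwS cats0.
apply: lsuppD; first apply: lsuppD; first apply: lsuppD.
- by apply: (lsupp_bprod_l c_tri _ us) => p r /dlt_above; apply: low.
- by apply: (lsupp_bprod_l c_tri _ (lsupp_tens _ ul)) => p r /dlt_above; apply: low.
- have gu : wsupp (fun p => p = u) (gen (FMonom u) : T) by apply: wsupp_gen.
  by apply: (lsupp_bprod c_tri (lsupp_tens _ gu) IHe) => p q r ->; apply: lowS.
rewrite -[coprod c B](subrK P) (linfD (@bprod_linear_r _ _ _ _ _)).
apply: lsuppD.
  apply: (lsupp_bprod_nil c_tri _ IHe) => q r uq rq.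
  have := low_or_above_dlt uq rq => -[[i ie ->]|ur]; last by right.
  by left; exists i => //; apply: ltnW.
have gP : lsupp (fun p => p = pw u e) P by apply: supported_gen.
apply: (lsupp_bprod_nil c_tri _ gP) => q r -> [->|ur].
  by left; exists e.
by right; apply: dlt_pw_above ur.
Qed.

(** Up to negligible left words the coproduct is (1 (x) a)(u^e (x) 1), that is, a single crossing of
    [brprod ls] with u^e. *)
Lemma coprod_brprod_exp ls e : (forall l, l \in ls -> lyn l /\ slt u l) ->
  lsupp (low_or_above e)
    (coprod c (brprod ls * br u ^+ e)
     - linext (fun q : word => gw g q (pw u e) *: gen (FMonom (pw u e), q))
              (brprod ls)).
Proof.
move=> lsL; have lsA := brprod_above lsL; have uE := coprod_br_exp e.
set a := brprod ls in lsA *; set B := br u ^+ e in uE *.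
set P := gen _ in uE; set L := linext _ _.
have gP : lead (pw u e) (gen (FMonom (pw u e)) : T) by apply: lead_gen.
have sP := bprod_swap c_tri a gP; rewrite -/L in sP.
have PE : P = tensor (gen (FMonom (pw u e))) 1 by rewrite malg1E tensorUU.
have -> : coprod c (a * B) - L =
    bprod c (coprod c a - tensor 1 a) (coprod c B)
    + bprod c (tensor 1 a) (coprod c B - P)
    + (bprod c (tensor 1 a) P - L).
  rewrite coprodM (linfB (@bprod_linear_l _ _ _ _ _)).
  by rewrite (linfB (@bprod_linear_r _ _ _ _ _)) !addrA !subrK.
apply: lsuppD; first apply: lsuppD.
- by apply: (lsupp_bprod_l c_tri _ lsA) => p r up; right; apply: above_cat.
- apply: (lsupp_bprod_nil c_tri _ uE) => q r; exact: low_or_above_dlt.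
by rewrite PE; apply: lsuppW sP _ => p /dlt_pw_above; right.
Qed.

End Above.

End BracketProducts.

(** * The standard order and normal words *)

Lemma epsilon_choice (A B : Type) (R : A -> B -> Prop) :
  (forall a, exists b, R a b) -> exists f, forall a, R a (f a).
Proof.
move=> H; exists (fun a => proj1_sig (constructive_indefinite_description _ (H a))).
by move=> a; apply: proj2_sig.
Qed.

Section StandardOrder.

Variables (d : Order.disp_t) (X : finOrderType d).
Implicit Types (s t r : seq X).

(** At equal length neither of two distinct words is a prefix of the other, so [dlt] is the
    lexicographic order there; in this form compatibility with concatenation on both sides is
    immediate. *)
Definition sgt s t : bool :=
  (size s < size t)%N || (size s == size t) && dlt t s.

Lemma std_gtE (v w : {fmonom X}) : std_gt v w = sgt v w.
Proof.
rewrite /std_gt /std_ge /sgt /lex_le leNgt -val_eqE /=.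
case: ltngtP => [vw|wv|szE] /=; rewrite ?andbF //.
  by rewrite andbT; apply: contraTneq vw => ->; rewrite ltnn.
rewrite -/(slt v w); apply/andP/idP => [[vnw vw]|wv].
  by apply: slt_dlt (sltNge vw vnw) _; rewrite szE.
split; first by apply: contraTneq wv => ->; rewrite dltxx.
by apply/negP => /(slt_trans (dlt_slt wv)); rewrite sltxx.
Qed.

Lemma sgtxx s : sgt s s = false.
Proof. by rewrite /sgt ltnn dltxx andbF. Qed.

Lemma sgt_trans : transitive sgt.
Proof.
move=> s t r; rewrite /sgt.
case/orP=> [ts|/andP[/eqP-> st]] /orP[sr|/andP[/eqP<- rs]].
- by rewrite (ltn_trans ts sr).
- by rewrite ts.
- by rewrite sr.
- by rewrite eqxx (dlt_trans rs st) orbT.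
Qed.

Lemma sgt_total s t : s != t -> sgt s t || sgt t s.
Proof.
rewrite /sgt; case: ltngtP => //= st sDt.
case/or3P: (slt_total s t) => [h|h|h]; last 1 first.
- by rewrite (slt_dlt h) ?st ?orbT.
- by rewrite (slt_dlt h) ?st ?orbT.
- by rewrite h in sDt.
Qed.

Lemma sgt_cat a b s t : sgt s t -> sgt (a ++ s ++ b) (a ++ t ++ b).
Proof.
rewrite /sgt !size_cat ltn_add2l ltn_add2r eqn_add2l eqn_add2r dlt_catl.
by case/orP=> [->//|/andP[-> /(dlt_cat b b) ->]]; rewrite orbT.
Qed.

Lemma sgt_size s t : sgt s t -> (size s <= size t)%N.
Proof. by case/orP => [/ltnW|/andP[/eqP->]]. Qed.

(* Only finitely many words are greater than a given one. *)
Lemma sgt_ind (Q : seq X -> Prop) :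
  (forall s, (forall t, sgt t s -> Q t) -> Q s) -> forall s, Q s.
Proof.
move=> H s; have [n sn] := ubnP (size s).
pose m s := #|[pred t : n.-bseq X | sgt t s]|.
have [N sN] := ubnP (m s); elim: N s sn sN => // N IHN s sn sN.
apply: H => t ts; have tn : (size t < n)%N by apply: leq_ltn_trans sn; apply: sgt_size.
apply: IHN => //; rewrite -ltnS; apply: leq_trans sN; rewrite ltnS.
apply: proper_card; apply/properP; split.
  by apply/subsetP => r; rewrite !inE => rt; apply: sgt_trans ts.
by exists (Bseq (ltnW tn)); rewrite !inE //= sgtxx.
Qed.

End StandardOrder.

Section NormalWords.

Variables (k : fieldType) (d : Order.disp_t) (X : finOrderType d).

Local Notation word := {fmonom X}.
Local Notation T := {malg k[{fmonom X}]}.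
Local Notation TT := {malg k[({fmonom X} * {fmonom X})%type]}.

Variable J : T -> Prop.
Hypothesis J_sub : subspace J.
Hypothesis J_mul : forall a b, J b -> J (a * b) /\ J (b * a).

Let J0 : J 0. Proof. by case: J_sub. Qed.
Let JD a b : J a -> J b -> J (a + b). Proof. by case: J_sub a b. Qed.
Let JZ x a : J a -> J (x *: a). Proof. by case: J_sub => _ _; apply. Qed.
Let JB a b : J a -> J b -> J (a - b).
Proof. by move=> Ja Jb; rewrite -scaleN1r; apply/JD/JZ. Qed.

Lemma wsupp_span (P : seq X -> Prop) (R : T -> Prop) a :
  R 0 -> (forall x y, R x -> R y -> R (x + y)) ->
  (forall x y, R y -> R (x *: y)) ->
  (forall s, P s -> R (gen (FMonom s))) -> wsupp P a -> R a.
Proof.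
move=> R0 RD RZ RP [Pa]; rewrite [a]malg_sum big_seq.
by apply: big_ind => // w /Pa/RP; rewrite fmK; apply: RZ.
Qed.

Definition redu s : Prop :=
  exists p q, [/\ wsupp (fun t => sgt t s) p, J q & gen (FMonom s) = p + q].

Lemma reducibleE s : reducible J (FMonom s) << FMonom s >> <-> redu s.
Proof.
rewrite genE; split=> -[p [q [pP Jq E]]]; exists p, q; split=> //.
  by split=> w /pP; rewrite std_gtE.
by move=> w wp; rewrite std_gtE; apply: supportedP pP wp.
Qed.

Definition normal s : Prop := ~ redu s.

Lemma redu_cat a b s : redu s -> redu (a ++ s ++ b).
Proof.
case=> p [q [pP Jq sE]].
exists (gen (FMonom a) * (p * gen (FMonom b))).
exists (gen (FMonom a) * (q * gen (FMonom b))); split.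
- have ga : wsupp (fun t => t = a) (gen (FMonom a) : T) by apply: wsupp_gen.
  have gb : wsupp (fun t => t = b) (gen (FMonom b) : T) by apply: wsupp_gen.
  apply: (wsupp_mul (Q := fun t => exists2 r, sgt r s & t = r ++ b) ga).
    by apply: (wsupp_mul pP gb) => r _ rs ->; exists r.
  by move=> _ _ -> [r rs ->]; apply: sgt_cat.
- by apply: (J_mul _ _).1; apply: (J_mul _ _).2.
by rewrite -mulrDr -mulrDl -sE !malgMUU.
Qed.

Lemma normal_factor a b s : normal (a ++ s ++ b) -> normal s.
Proof. by move=> abs /(redu_cat a b). Qed.

Lemma normal_nil : ~ J 1 -> normal [::].
Proof.
move=> J1 [p [q [[pP] Jq E]]]; apply: J1; rewrite malg1E E.
suff -> : p = 0 by rewrite add0r.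
apply/malgP => w; rewrite mcoeff0; apply: mcoeff_outdom; apply/negP => /pP.
by rewrite /sgt; case: (fmonom_val w).
Qed.

Lemma normal_form_exists s : exists z,
  wsupp (fun t => normal t /\ (t = s \/ sgt t s)) z /\ J (gen (FMonom s) - z).
Proof.
elim/sgt_ind: s => s IHs.
have [[p [q [pP Jq sE]]]|sN] := classic (redu s); last first.
  exists (gen (FMonom s)); rewrite subrr; split=> //.
  by apply: wsupp_gen; split=> //; left.
pose R a := exists z,
  wsupp (fun t => normal t /\ (t = s \/ sgt t s)) z /\ J (a - z).
have [z [zP Jz]] : R p.
  apply: (@wsupp_span (fun t => sgt t s) R) pP.
  - by exists 0; rewrite subrr; split=> //; apply: wsupp0.
  - move=> x y [z [zP Jz]] [z' [zP' Jz']]; exists (z + z').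
    by split; [apply: wsuppD | rewrite opprD addrACA; apply: JD].
  - move=> x y [z [zP Jz]]; exists (x *: z).
    by split; [apply: wsuppZ | rewrite -scalerBr; apply: JZ].
  move=> t ts; have [z [zP Jz]] := IHs t ts; exists z; split=> //.
  apply: wsuppW zP _ => r [rN rt]; split=> //; right.
  by case: rt => [->|/sgt_trans]; [|apply].
by exists z; split=> //; rewrite sE addrAC; apply: JD.
Qed.

(** Otherwise [z], divided by the coefficient of the least word of its support, would express that
    word modulo J through greater ones. *)
Lemma normal_indep z : wsupp normal z -> J z -> z = 0.
Proof.
move=> [zN] Jz; apply/eqP; rewrite -msupp_eq0; apply/negP => /negP.
case/fset0Pn => w0 w0z.
pose le (v w : word) := (v == w) || sgt w v.
have leT : total le.
  move=> v w; rewrite /le; have [//|vw] := eqVneq v w.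
  by rewrite /= orbC; have := @sgt_total _ _ v w vw; rewrite orbA orbAC => ->.
have ler : transitive le.
  move=> v u w /orP[/eqP-> //|vu] /orP[/eqP<-|wv]; rewrite /le ?vu ?orbT //.
  by rewrite (sgt_trans wv vu) orbT.
have [|w wz wmin] := seq_min (s := msupp z) leT ler.
  by apply: contraTneq w0z => E; rewrite -[_ \in _]/(_ \in enum_fset _) E.
have zw : z@_w != 0 by rewrite mcoeff_neq0.
apply: (zN w wz).
exists (gen w - (z@_w)^-1 *: z), ((z@_w)^-1 *: z); split.
- split=> v; rewrite -mcoeff_neq0 mcoeffB mcoeffZ mcoeff_gen => vP.
  have vw : v != w.
    by apply: contraNneq vP => ->; rewrite eqxx mulVf // subrr.
  have /wmin : v \in msupp z.
    rewrite -mcoeff_neq0; apply: contraNneq vP => ->.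
    by rewrite mulr0 subr0 [w == v]eq_sym (negbTE vw).
  by rewrite /le [w == v]eq_sym (negbTE vw).
- exact: JZ.
by rewrite subrK fmK.
Qed.

(** A projection onto the span of the normal words along J. The last property makes the coefficient
    at [s] blind to all words greater than [s]. *)
Lemma normal_form_map : exists nf : T -> T,
  [/\ linear nf, forall a, J (a - nf a), forall a, J a -> nf a = 0,
      forall s, normal s -> nf (gen (FMonom s)) = gen (FMonom s)
    & forall s t, sgt t s -> (nf (gen (FMonom t)))@_(FMonom s) = 0].
Proof.
have [f fP] := epsilon_choice normal_form_exists.
pose nf a := linext (fun w : word => f w) a.
have nfL : linear nf by apply: linext_is_linear.
have nfU w : nf (gen w) = f w by rewrite /nf linextU.
have nfJ a : J (a - nf a).
  apply: (@wsupp_span (fun=> True) (fun a => J (a - nf a))); last by split.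
  - by rewrite (linf0 nfL) subrr.
  - by move=> x y Jx Jy; rewrite (linfD nfL) opprD addrACA; apply: JD.
  - by move=> x y Jy; rewrite (linfZ nfL) -scalerBr; apply: JZ.
  by move=> s _; rewrite nfU; case: (fP s).
have nfN a : wsupp normal (nf a).
  apply: (@supported_linext _ _ _ (fun=> True)) => // w _.
  by apply: wsuppW (fP w).1 _ => s [].
exists nf; split=> //.
- move=> a Ja; apply: normal_indep => //.
  by rewrite -[nf a](subKr a); apply: JB => //; apply: nfJ.
- move=> s sN; apply/esym/eqP; rewrite -subr_eq0; apply/eqP.
  apply: normal_indep; last exact: nfJ.
  by apply: wsuppB; [exact: wsupp_gen | exact: nfN].
move=> s t ts; rewrite nfU; apply: supported_coef0 (fP t).1 _ => -[_ /=].
case=> [E|/sgt_trans /(_ ts)]; last by rewrite sgtxx.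
by move: ts; rewrite E sgtxx.
Qed.

End NormalWords.

(** * Coordinates modulo J in both tensor factors *)

Section PairEvaluation.

Variables (k : fieldType) (d : Order.disp_t) (X : finOrderType d).

Local Notation word := {fmonom X}.
Local Notation T := {malg k[{fmonom X}]}.
Local Notation TT := {malg k[({fmonom X} * {fmonom X})%type]}.

Variables (J : T -> Prop) (nf : T -> T).
Hypothesis nfL : linear nf.
Hypothesis nfJ : forall a, J a -> nf a = 0.
Hypothesis nfN : forall s, normal J s -> nf (gen (FMonom s)) = gen (FMonom s).
Hypothesis nfG : forall s t, sgt t s -> (nf (gen (FMonom t)))@_(FMonom s) = 0.

Definition evpair (s t : seq X) (z : TT) : k :=
  (tmap nf nf z)@_(FMonom s, FMonom t).

Lemma evpair_linear s t : linear (evpair s t : TT -> k^o).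
Proof. by move=> x a b; rewrite /evpair !tmapE linearP mcoeffD mcoeffZ. Qed.

Lemma evpair_gen s t : normal J s -> normal J t ->
  evpair s t (gen (FMonom s, FMonom t)) = 1.
Proof.
move=> sN tN; rewrite /evpair tmapE linextU mcoeff_tensor !nfN //.
by rewrite !mcoeff_gen !eqxx mulr1.
Qed.

Lemma evpair_low s t z :
  supported (fun p : word * word => sgt p.1 s \/ sgt p.2 t) z ->
  evpair s t z = 0.
Proof.
case=> zP; rewrite /evpair tmapE linextE raddf_sum /= big_seq big1 // => p pz.
rewrite mcoeffZ mcoeff_tensor; case: (zP p pz) => /nfG; rewrite fmK => ->.
  by rewrite mul0r mulr0.
by rewrite !mulr0.
Qed.

Lemma evpair_tens_ideal s t z : tens_ideal J z -> evpair s t z = 0.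
Proof.
case=> l lJ ->; rewrite /evpair tmapE linear_sum raddf_sum /=.
rewrite big_seq big1 // => p pl; rewrite -tmapE tens_tensor tmap_tensor //.
rewrite mcoeff_tensor.
by case: (lJ p pl) => /nfJ ->; rewrite mcoeff0 ?mul0r ?mulr0.
Qed.

End PairEvaluation.

(** * Words with normal Lyndon blocks *)

Section Noninc.

Variables (d : Order.disp_t) (X : finOrderType d).
Implicit Types (u l : seq X) (ls : seq (seq X)).

Lemma nslt_trans : transitive (fun v w : seq X => ~~ slt v w).
Proof.
move=> t s r; rewrite /slt -!(@leNgt _ (seqlexi X)) => ts rt.
exact: (@le_trans _ (seqlexi X)) rt ts.
Qed.

Lemma noninc_split u ls : noninc ls ->
  ls = filter (slt u) ls ++ nseq (count_mem u ls) u ++ filter (fun x => slt x u) ls.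
Proof.
rewrite /noninc; elim: ls => [|h t IHt] //= ht.
have tS := path_sorted ht.
have {ht} /allP hmin := order_path_min nslt_trans ht.
have [uh|uh] := boolP (slt u h).
  have -> : (h == u) = false by apply: contraTF uh => /eqP->; rewrite sltxx.
  have -> : slt h u = false.
    by apply: contraTF uh => hu; apply/negP => /(slt_trans hu); rewrite sltxx.
  by rewrite add0n cat_cons -IHt.
have tu0 : filter (slt u) t = [::].
  apply/eqP; rewrite -(negbK (_ == _)) -has_filter; apply/hasPn => x /hmin hx.
  by apply: nslt_trans uh hx.
have [->|hu] := eqVneq h u.
  by rewrite sltxx add1n /= tu0 /= {1}IHt // tu0.
have {}hu : slt h u by apply: sltNge uh _; rewrite eq_sym.
have ut : u \notin t by apply/negP => /hmin; rewrite hu.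
by rewrite hu add0n {1}IHt // tu0 (count_memPn ut).
Qed.

End Noninc.

Section PBWWords.

Variables (k : fieldType) (d : Order.disp_t) (X : finOrderType d).
Variable c : {malg k[(X * X)%type]} -> {malg k[(X * X)%type]}.
Variable g : X -> X -> k.

Local Notation word := {fmonom X}.
Local Notation T := {malg k[{fmonom X}]}.
Local Notation TT := {malg k[({fmonom X} * {fmonom X})%type]}.

Hypothesis c_tri : forall x y,
  supported (fun p : X * X => (y < p.1)%O)
            (c (gen (x, y)) - g x y *: gen (y, x)).
Hypothesis g_neq0 : forall x y, g x y != 0.

Variable br : seq X -> T.
Hypothesis brP : forall u, lyn u ->
  [/\ lead u (br u), wsupp (perm_eq^~ u) (br u)
    & skew_primitive c (dlt u) (br u)].

Section Evaluation.

Variables (J : T -> Prop) (nf : T -> T).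
Hypothesis nfL : linear nf.
Hypothesis nfN : forall s, normal J s -> nf (gen (FMonom s)) = gen (FMonom s).
Hypothesis nfG : forall s t, sgt t s -> (nf (gen (FMonom t)))@_(FMonom s) = 0.

Variables (u v : seq X) (e : nat).
Hypotheses (uL : lyn u) (uN : normal J (pw u e)) (vN : normal J v).

Let ev := evpair nf (pw u e) v.
Let evL : linear (ev : TT -> k^o). Proof. exact: evpair_linear. Qed.

(** If [p] is longer than u^e, then [q] is shorter than [v]. At equal length [p] cannot be a lower
    power of [u], so it exceeds uuu... and therefore u^e. *)
Let pair_low p q : (size p + size q = size (pw u e) + size v)%N ->
  low_or_above u e p -> sgt p (pw u e) \/ sgt q v.
Proof.
move=> pq pP; case: (ltngtP (size p) (size (pw u e))) => [pu|pu|pu].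
- by left; rewrite /sgt pu.
- right; rewrite /sgt; apply/orP; left.
  by rewrite -(ltn_add2l (size p)) pq ltn_add2r.
left; rewrite /sgt pu eqxx; apply/orP; right.
case: pP => [[i ie pE]|up].
  move/eqP: pu; rewrite pE !size_pw eqn_mul2r => /orP[|/eqP iE].
    by rewrite size_eq0; case: uL => /negbTE->.
  by rewrite iE ltnn in ie.
by apply: above_size => //; rewrite pu size_pw.
Qed.

Let ev_low z :
  supported (fun p : word * word =>
               (size p.1 + size p.2 = size (pw u e) + size v)%N) z ->
  lsupp (low_or_above u e) z -> ev z = 0.
Proof.
move=> zs zl; apply: (evpair_low nfG).
by apply: supportedW (supported_and zs zl) _ => p [/pair_low].
Qed.

Lemma ev_coprod_short a n : (n < size (pw u e) + size v)%N ->
  wsupp (fun s => size s = n) a -> ev (coprod c a) = 0.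
Proof.
move=> ne an; apply: (evpair_low nfG).
apply: supportedW (coprod_size c an) _ => p pn.
case: (ltnP (size p.1) (size (pw u e))) => [h|h]; first by left; rewrite /sgt h.
right; rewrite /sgt; apply/orP; left.
by rewrite -(ltn_add2l (size p.1)) pn (leq_trans ne) // leq_add2r.
Qed.

Variables (ls : seq (seq X)) (i : nat).
Hypothesis lsL : forall l, l \in ls -> lyn l /\ slt u l.
Hypothesis size_ls :
  (size (flatten ls) + size (pw u i) = size (pw u e) + size v)%N.

Let lsL' l : l \in ls -> lyn l. Proof. by case/lsL. Qed.
Let a := brprod br ls * br u ^+ i.
Let L := linext (fun q : word => gw g q (pw u i) *: gen (FMonom (pw u i), q))
                (brprod br ls).

Let br_exp_size : wsupp (fun s => size s = size (pw u i)) (br u ^+ i).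
Proof.
have [_ up _] := brP uL; elim: (i) => [|j IHj].
  by rewrite expr0 malg1E; apply: wsupp_gen.
rewrite exprS; apply: (wsupp_mul up IHj) => p q /perm_size pu qj.
by rewrite size_cat pu qj pwS size_cat.
Qed.

Let brprod_size : wsupp (fun s => size s = size (flatten ls)) (brprod br ls).
Proof. by apply: wsuppW (brprod_perm brP lsL') _ => s /perm_size. Qed.

Let a_size : wsupp (fun s => size s = size (pw u e) + size v)%N a.
Proof.
apply: (wsupp_mul brprod_size br_exp_size) => p q ps qs.
by rewrite size_cat ps qs.
Qed.

Let L_size :
  supported (fun p : word * word =>
               (size p.1 + size p.2 = size (pw u e) + size v)%N) L.
Proof.
apply: (supported_linext brprod_size) => q qs; apply: supportedZ.
by apply: supported_gen; rewrite /= qs addnC.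
Qed.

Let low_mon j p : (j <= e)%N -> low_or_above u j p -> low_or_above u e p.
Proof.
move=> je [[m mj ->]|]; last by right.
by left; exists m => //; apply: leq_trans je.
Qed.

Let ev_rest : (i <= e)%N -> ev (coprod c a - L) = 0.
Proof.
move=> ie; apply: ev_low.
  by apply: supportedB; [apply: coprod_size | exact: L_size].
by apply: lsuppW (coprod_brprod_exp c_tri brP uL i lsL) _ => p; apply: low_mon.
Qed.

Lemma ev_coprod_lower : (i < e)%N -> ev (coprod c a) = 0.
Proof.
move=> ie; rewrite -[coprod c a](subrK L) (linfD evL) ev_rest ?(ltnW ie) // add0r.
apply: ev_low => //; apply: (supported_linext brprod_size) => q _.
by apply: supportedZ; apply: supported_gen; left; exists i.
Qed.

(** Only the leading word of [brprod br ls] can reach [v]: its other words exceed [flatten ls],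
    which is itself at least [v]. *)
Lemma ev_coprod_top : i = e -> (v = flatten ls \/ dlt v (flatten ls)) ->
  ev (coprod c a) = if v == flatten ls then gw g v (pw u e) else 0.
Proof.
move=> ie vls; rewrite -[coprod c a](subrK L) (linfD evL) ev_rest ?ie // add0r.
have sv : size (flatten ls) = size v.
  by apply/eqP; rewrite -(eqn_add2r (size (pw u i))) size_ls ie addnC.
have -> : L = linext (fun q : word => gw g q (pw u i) *: gen (FMonom (pw u i), q))
      (brprod br ls - gen (FMonom (flatten ls)))
    + gw g (flatten ls) (pw u i)
      *: gen (FMonom (pw u i), FMonom (flatten ls)).
  by rewrite /L -[X in linext _ X](subrK (gen (FMonom (flatten ls)))) linextD linextU.
have qP q : size q = size (flatten ls) -> dlt (flatten ls) q -> sgt q v.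
  move=> qs lq; rewrite /sgt qs sv ltnn eqxx /=.
  by case: vls => [->//|/dlt_trans]; apply.
rewrite (linfD evL) (_ : ev (linext _ _) = 0) ?add0r; last first.
  have Bs : wsupp (fun s => size s = size (flatten ls))
      (brprod br ls - gen (FMonom (flatten ls))).
    by apply: wsuppB brprod_size _; apply: wsupp_gen.
  apply: (evpair_low nfG).
  apply: (supported_linext (supported_and Bs (brprod_lead brP lsL'))) => q [qs lq].
  by apply: supportedZ; apply: supported_gen; right; apply: qP.
rewrite (linfZ evL) ie.
case: eqP => [<-|vNl]; first by rewrite /ev (evpair_gen nfN uN vN); apply: mulr1.
rewrite (_ : ev _ = 0) ?scaler0 //; apply: (evpair_low nfG).
apply: supported_gen; right; rewrite /sgt /= sv ltnn eqxx /=.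
by case: vls.
Qed.

End Evaluation.

End PBWWords.

Lemma dlt_catr_size (d : Order.disp_t) (X : orderType d) (p q r : seq X) :
  size p = size q -> dlt (p ++ r) (q ++ r) -> dlt p q.
Proof.
elim: p q => [|a p IHp] [|b q] //= => [_|[pq] /orP[->//|/andP[-> /(IHp _ pq)->]]].
  by rewrite dltxx.
by rewrite orbT.
Qed.

(** * Normal words are exactly the words with normal blocks *)

Section PBWTheorem.

Variables (k : fieldType) (d : Order.disp_t) (X : finOrderType d).
Variable c : {malg k[(X * X)%type]} -> {malg k[(X * X)%type]}.
Variable g : X -> X -> k.

Local Notation word := {fmonom X}.
Local Notation T := {malg k[{fmonom X}]}.
Local Notation TT := {malg k[({fmonom X} * {fmonom X})%type]}.

Hypothesis c_tri : forall x y,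
  supported (fun p : X * X => (y < p.1)%O)
            (c (gen (x, y)) - g x y *: gen (y, x)).
Hypothesis g_neq0 : forall x y, g x y != 0.

Variable J : T -> Prop.
Hypothesis J_sub : subspace J.
Hypothesis J_mul : forall a b, J b -> J (a * b) /\ J (b * a).
Hypothesis J1 : ~ J 1.
Hypothesis J_co : forall a, J a -> tens_ideal J (coprod c a).

(** In a nonincreasing list equal factors are adjacent, so [pw l (count_mem l ls)] is the full block
    of [l] inside [flatten ls]. *)
Definition pbw (ls : seq (seq X)) : Prop :=
  [/\ noninc ls, forall l, l \in ls -> lyn l
    & forall l, l \in ls -> normal J (pw l (count_mem l ls))].

Definition pbw_word (s : seq X) : Prop := exists2 ls, pbw ls & flatten ls = s.

Lemma pbw_word_of_normal s : normal J s -> pbw_word s.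
Proof.
move=> sN; have [ls [lsS lsL lsE]] := lyn_factorization s.
exists ls => //; split=> // l lls; move: sN.
rewrite -lsE {1}(noninc_split l lsS) !flatten_cat.
exact: normal_factor.
Qed.

(** When [u] is the least factor, this removes the last block and leaves a shorter word to which the
    induction on length applies. *)
Lemma pbw_filter u ls : pbw ls -> pbw (filter (slt u) ls).
Proof.
case=> lsS lsL lsN; split.
- exact: (sorted_filter (@nslt_trans _ X)).
- by move=> l; rewrite mem_filter => /andP[_ /lsL].
move=> l; rewrite mem_filter => /andP[ul lls].
have -> : count_mem l (filter (slt u) ls) = count_mem l ls; last exact: lsN.
rewrite count_filter; apply: eq_count => x /=.
by case: eqVneq => [->|].
Qed.

Section Independence.

Variable br : seq X -> T.
Hypothesis brP : forall u, lyn u ->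
  [/\ lead u (br u), wsupp (perm_eq^~ u) (br u)
    & skew_primitive c (dlt u) (br u)].

Variable dec : seq X -> seq (seq X).
Hypothesis decP : forall s, pbw_word s -> pbw (dec s) /\ flatten (dec s) = s.

Let E (w : word) : T := brprod br (dec w).

(** The conclusion says that [z] has no word of the top length N. Shorter words are allowed in [z]
    since J need not be homogeneous, and their normality is assumed because the right-hand target
    [v] is one of them. *)
Lemma pbw_independence N z :
  (forall s, (size s < N)%N -> pbw_word s -> normal J s) ->
  wsupp (fun s => pbw_word s /\ (size s <= N)%N) z -> J (linext E z) ->
  forall w : word, w \in msupp z -> size w = N -> (0 < N)%N -> False.
Proof.
move=> IH [zP] Jz w0 w0z w0N N0.
have [nf [nfL _ nfJ nfN nfG]] := normal_form_map J_sub.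
pose W := [seq w : word <- msupp z | size w == N].
have WP w : w \in W -> [/\ pbw (dec w), flatten (dec w) = w, size w = N
    & w \in msupp z].
  rewrite mem_filter => /andP[/eqP wN wz].
  by have [/decP[wP wE] _] := zP w wz.
have w0W : w0 \in W by rewrite mem_filter w0N eqxx.
pose U := flatten [seq dec w | w : word <- W].
have U0 : U != [::].
  have [_ E0 _ _] := WP _ w0W; have : dec w0 != [::].
    by apply: contraTneq N0 => D0; rewrite -w0N -E0 D0.
  case D0 : (dec w0) => [//|l t] _.
  have : l \in U by apply/flatten_mapP; exists w0; rewrite // D0 mem_head.
  by case: U.
have [u /flatten_mapP[wu wuW uwu] umin] :=
  seq_min (@le_total _ (seqlexi X)) (@le_trans _ (seqlexi X)) U0.
have uL : lyn u by have [[_ L _] _ _ _] := WP _ wuW; apply: L.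
have u0 : (0 < size u)%N by rewrite lt0n size_eq0; case: uL.
pose cnt (w : word) := count_mem u (dec w).
have [|||wm wmW wmax] := @seq_min _ (fun v w => cnt w <= cnt v)%N W.
- by move=> v w; apply: leq_total.
- by move=> v w t vw tv; apply: leq_trans tv vw.
- by apply: contraTneq w0W => ->.
pose e := cnt wm.
have e0 : (0 < e)%N.
  by apply: leq_trans (wmax _ wuW); rewrite -has_count has_pred1.
pose F (w : word) := filter (slt u) (dec w).
have decE w : w \in W -> dec w = F w ++ nseq (cnt w) u.
  move=> wW; have [[S _ _] _ _ _] := WP w wW.
  rewrite {1}(noninc_split u S) -[in LHS]/(F w) -/(cnt w).
  suff -> : filter (fun x => slt x u) (dec w) = [::] by rewrite cats0.
  apply/eqP; rewrite -(negbK (_ == _)) -has_filter; apply/hasPn => l lw.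
  by rewrite /slt -leNgt; apply: umin; apply/flatten_mapP; exists w.
have valE w : w \in W -> fmonom_val w = flatten (F w) ++ pw u (cnt w).
  by move=> wW; have [_ <- _ _] := WP w wW; rewrite {1}decE // flatten_cat.
have EE w : w \in W -> E w = brprod br (F w) * br u ^+ cnt w.
  by move=> wW; rewrite /E decE // /brprod big_cat /= big_nseq iter_mulr_1.
have FL w : w \in W -> forall l, l \in F w -> lyn l /\ slt u l.
  move=> wW l; have [[_ L _] _ _ _] := WP w wW.
  by rewrite mem_filter => /andP[ul /L].
pose W' := [seq w <- W | cnt w == e].
have wmW' : wm \in W' by rewrite mem_filter eqxx.
have [|||w1 w1W' w1min] := @seq_min _
  (fun v w : word => @Order.le _ (seqlexi X) (v : seq X) (w : seq X)) W'.
- by move=> v w; apply: (@le_total _ (seqlexi X)).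
- by move=> v w t; apply: (@le_trans _ (seqlexi X)).
- by apply: contraTneq wmW' => ->.
move: (w1W'); rewrite mem_filter => /andP[/eqP w1e w1W].
pose v := flatten (F w1).
have sizeW w : w \in W -> (size (flatten (F w)) + size (pw u (cnt w)) =
    size (pw u e) + size v)%N.
  move=> wW; rewrite -size_cat -valE // [RHS]addnC -size_cat -w1e -valE //.
  by have [_ _ -> _] := WP _ wW; have [_ _ -> _] := WP _ w1W.
have sizeN : (size (pw u e) + size v = N)%N.
  by rewrite -(sizeW _ w1W) -size_cat -valE //; have [_ _ -> _] := WP _ w1W.
have [w1P _ _ w1z] := WP _ w1W.
have uN : normal J (pw u e).
  have [_ _ Nm] := w1P; rewrite -w1e; apply: Nm.
  by rewrite -has_pred1 has_count -/(cnt w1) w1e.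
have vN : normal J v.
  apply: IH; last by exists (F w1) => //; apply: pbw_filter.
  by rewrite -sizeN -[X in (X < _)%N]add0n ltn_add2r size_pw muln_gt0 e0.
pose ev : TT -> k^o := evpair nf (pw u e) v.
have evL : linear (fun a => ev (coprod c a)).
  by move=> x a b; rewrite coprod_linear; apply: evpair_linear.
have : ev (coprod c (linext E z)) = 0.
  exact: (evpair_tens_ideal nfL nfJ _ _ (J_co Jz)).
rewrite (linext_comp _ _ evL) linextE (bigD1_seq w1) ?fset_uniq //= big_seq_cond.
rewrite big1 ?addr0; last first.
  (* The other words of [z] contribute nothing: they are shorter than N, or have a smaller exponent
     of [u], or have exponent [e] and a remaining part greater than [v]. *)
  move=> w /andP[wz ww1]; suff -> : ev (coprod c (E w)) = 0 by rewrite scaler0.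
  have [/decP[wP wE] wN] := zP w wz.
  have [wl|wl] := ltnP (size w) N.
    have Ew : wsupp (fun s => size s = size w) (E w).
      have [_ L _] := wP; apply: wsuppW (brprod_perm brP L) _ => s.
      by rewrite wE => /perm_size.
    by apply: (ev_coprod_short c nfG _ Ew); rewrite sizeN.
  have wW : w \in W by rewrite mem_filter wz andbT eqn_leq wN.
  have ce : (cnt w <= e)%N by apply: wmax.
  rewrite EE //; have [lt|eq] : (cnt w < e)%N \/ cnt w = e.
    by move: ce; rewrite leq_eqVlt => /orP[/eqP|]; [right|left].
    exact: (ev_coprod_lower c_tri brP nfG uL (FL _ wW) (sizeW _ wW)).
  have wW' : w \in W' by rewrite mem_filter eq eqxx.
  have sw : size v = size (flatten (F w)).
    apply/eqP; rewrite -(eqn_add2l (size (pw u e))) -(sizeW _ wW) eq.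
    by rewrite addnC.
  (* Both words end in u^e and have length N; cancelling this common end turns the minimality of
     [w1] into a comparison of the remaining parts. *)
  have vw : dlt v (flatten (F w)).
    apply: (dlt_catr_size (r := pw u e)) => //.
    rewrite -{1}w1e -eq -!valE //; apply: slt_dlt.
      apply: sltNge; last by rewrite -fmP.
      by rewrite /slt -leNgt; apply: w1min.
    by have [_ _ -> _] := WP _ wW; have [_ _ -> _] := WP _ w1W.
  apply: etrans (ev_coprod_top c_tri brP nfN nfG uL uN vN (FL _ wW)
    (sizeW _ wW) eq (or_intror vw)) _.
  by case: eqP vw => // ->; rewrite dltxx.
have ev1 : ev (coprod c (brprod br (F w1) * br u ^+ cnt w1)) = gw g v (pw u e).
  apply: etrans (ev_coprod_top c_tri brP nfN nfG uL uN vN (FL _ w1W)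
    (sizeW _ w1W) w1e (or_introl erefl)) _.
  by rewrite eqxx.
rewrite EE // ev1 => /eqP; rewrite scaler_eq0 mcoeff_eq0 w1z /=.
by rewrite (negbTE (gw_neq0 g_neq0 _ _)).
Qed.

Let lead_sgt s : pbw_word s ->
  wsupp (fun t => sgt t s) (E (FMonom s) - gen (FMonom s)).
Proof.
move=> /decP[[_ L _] sE]; have := brprod_lead brP L; rewrite sE => sl.
have sp : wsupp (fun t => size t = size s) (E (FMonom s) - gen (FMonom s)).
  apply: wsuppB; last exact: wsupp_gen.
  by apply: wsuppW (brprod_perm brP L) _ => t; rewrite /= sE => /perm_size.
apply: supportedW (supported_and sl sp) _ => t [lt st].
by rewrite /sgt st eqxx lt orbT.
Qed.

Let JD a b : J a -> J b -> J (a + b). Proof. by case: J_sub a b. Qed.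
Let JZ x a : J a -> J (x *: a). Proof. by case: J_sub => _ _; apply. Qed.

Let reduction_span (Q : seq X -> Prop) s a :
  (forall t, Q t -> exists z,
     wsupp (fun r => pbw_word r /\ (r = t \/ sgt r t)) z /\
     J (gen (FMonom t) - linext E z)) ->
  (forall t, Q t -> sgt t s) -> wsupp Q a -> exists z,
  wsupp (fun r => pbw_word r /\ sgt r s) z /\ J (a - linext E z).
Proof.
move=> H Qs; pose R a := exists z,
  wsupp (fun r => pbw_word r /\ sgt r s) z /\ J (a - linext E z).
apply: (wsupp_span (R := R)) => [|x y [z [zP Jz]] [z' [zP' Jz']]|x y [z [zP Jz]]|t Qt].
- exists 0; rewrite linear0 subrr; split; first exact: wsupp0.
  by case: J_sub.
- exists (z + z'); split; first exact: wsuppD.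
  by rewrite linextD opprD addrACA; apply: JD.
- exists (x *: z); split; first exact: wsuppZ.
  by rewrite linextZ -scalerBr; apply: JZ.
have [z [zP Jz]] := H t Qt; exists z; split=> //.
apply: wsuppW zP _ => r [rP rt]; split=> //.
by case: rt => [->|/sgt_trans]; [|apply]; apply: Qs.
Qed.

(** A reducible [t] is traded for greater words modulo J. A normal [t] is a [pbw_word], and it
    differs from its bracket product [E] by greater words. *)
Lemma bracket_reduction t : exists z,
  wsupp (fun r => pbw_word r /\ (r = t \/ sgt r t)) z /\
  J (gen (FMonom t) - linext E z).
Proof.
elim/sgt_ind: t => t IHt.
have [[p [q [pP Jq tE]]]|tN] := classic (redu J t).
  have [z [zP Jz]] := reduction_span IHt (fun=> id) pP.
  exists z; split; last by rewrite tE addrAC; apply: JD.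
  by apply: wsuppW zP _ => r [rP rt]; split=> //; right.
have tP := pbw_word_of_normal tN.
have [z [zP Jz]] := reduction_span IHt (fun=> id) (lead_sgt tP).
exists (gen (FMonom t) - z); split.
  apply: wsuppB; first by apply: wsupp_gen; split=> //; left.
  by apply: wsuppW zP _ => r [rP rt]; split=> //; right.
rewrite (linfB (linext_is_linear _)) linextU.
have := JZ (-1) Jz; rewrite scaleN1r !opprB addrA.
by rewrite [linext E z + _]addrC -addrA.
Qed.

(** If [s] were reducible, its bracket product would be, modulo J, a combination of those of greater
    words. This relation has coefficient 1 at [s] and involves no longer word, so [pbw_independence]
    excludes it. *)
Lemma normal_of_pbw_word s : pbw_word s -> normal J s.
Proof.
have [n] := ubnP (size s); elim: n s => // n IHn s; rewrite ltnS => sn sP.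
(* The empty word has no Lyndon factor to single out; its normality is the properness of J. *)
have [s0|s0] := eqVneq s [::]; first by rewrite s0; apply: normal_nil.
case=> p [q [pP Jq sE]].
have [z [zP Jz]] := reduction_span (fun t (_ : sgt t s) => bracket_reduction t)
  (fun=> id) (wsuppD pP (lead_sgt sP)).
have zs : (gen (FMonom s) - z)@_(FMonom s) != 0.
  rewrite mcoeffB mcoeff_gen eqxx (supported_coef0 zP) ?subr0 ?oner_eq0 //=.
  by rewrite sgtxx => -[].
apply: (@pbw_independence (size s) (gen (FMonom s) - z)) (FMonom s) _ _ _ => //.
- by move=> t ts; apply: IHn; apply: leq_trans sn.
- apply: wsuppB; first exact: wsupp_gen.
  by apply: wsuppW zP _ => r [rP /sgt_size].
- rewrite (linfB (linext_is_linear _)) linextU.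
  have := JD Jz Jq; congr J; rewrite addrAC; congr (_ - _).
  by rewrite addrAC -sE addrC subrK.
- by rewrite -mcoeff_neq0.
by rewrite lt0n size_eq0.
Qed.

End Independence.

Theorem normal_pbw_word s : normal J s <-> pbw_word s.
Proof.
split; first exact: pbw_word_of_normal.
have brE u : exists b, lyn u ->
    [/\ lead u b, wsupp (perm_eq^~ u) b & skew_primitive c (dlt u) b].
  have [uL|uL] := classic (lyn u); last by exists 0.
  by have [b bP] := bracket_exists c_tri g_neq0 uL; exists b.
have [br brP] := epsilon_choice brE.
have decE t : exists ls, pbw_word t -> pbw ls /\ flatten ls = t.
  by have [[ls lsP lsE]|tP] := classic (pbw_word t); [exists ls | exists [::]].
have [dec decP] := epsilon_choice decE.
exact: (@normal_of_pbw_word br brP dec decP s).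
Qed.

End PBWTheorem.

(** * Nonvanishing of the diagonal coefficients *)

Section TriangularBraiding.

Variables (k : fieldType) (d : Order.disp_t) (X : finOrderType d).
Variable c : {malg k[(X * X)%type]} -> {malg k[(X * X)%type]}.
Variable beta : X -> X -> k.
Hypothesis cL : linear c.
Hypothesis c_inj : injective c.
Hypothesis c_tri : forall x y,
  supported (fun p : X * X => (x < p.2)%O)
            (c (gen (x, y)) - beta x y *: gen (y, x)).

(* From the top letter down, c is onto V (x) span(z >= x) already on
   span(z >= x) (x) V, so a vanishing coefficient contradicts injectivity. *)
Lemma triangular_neq0 x y : beta x y != 0.
Proof.
suff: (forall y, beta x y != 0) /\
    forall y, exists2 m, supported (fun p : X * X => (x <= p.1)%O) m
      & c m = gen (y, x) by case.
pose up (z : X) := #|[pred t | (z < t)%O]|.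
have [n] := ubnP (up x); elim: n x {y} => // n IHn x xn.
have onto r : supported (fun p : X * X => (x < p.2)%O) r ->
    exists2 m, supported (fun p : X * X => (x < p.1)%O) m & c m = r.
  case=> rP; rewrite [r]malg_sum big_seq.
  pose Q (r : {malg k[(X * X)%type]}) :=
    exists2 m, supported (fun p : X * X => (x < p.1)%O) m & c m = r.
  apply: (big_ind Q) => [|_ _ [m mP <-] [m' mP' <-]|[y z] /rP /= xz].
  - by exists 0; [exact: supported0 | rewrite (linf0 cL)].
  - by exists (m + m'); [exact: supportedD | rewrite (linfD cL)].
  have [|_ /(_ y)[m mP mE]] := IHn z.
    rewrite -ltnS; apply: leq_trans xn; rewrite ltnS; apply: proper_card.
    apply/properP; split; last by exists z; rewrite !inE ?ltxx.
    by apply/subsetP => t; rewrite !inE; apply: lt_trans.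
  exists (r@_(y, z) *: m); last by rewrite (linfZ cL) mE.
  by apply/supportedZ/(supportedW mP) => p; apply: lt_le_trans.
have bN y : beta x y != 0.
  apply/eqP => b0; have [m mP] := onto _ (c_tri x y).
  rewrite b0 scale0r subr0 => /c_inj mE.
  have := supportedP mP; rewrite mE => /(_ (x, y)).
  by rewrite msupp_gen inE eqxx ltxx => /(_ isT).
split=> // y; have [m mP mE] := onto _ (c_tri x y).
exists ((beta x y)^-1 *: (gen (x, y) - m)).
  apply: supportedZ; apply: supportedB; first by apply: supported_gen; rewrite /=.
  by apply: supportedW mP _ => p /ltW.
by rewrite (linfZ cL) (linfB cL) mE subKr scalerA mulVf ?scale1r.
Qed.

Lemma flip_triangular x y :
  supported (fun p : X * X => (y < p.1)%O)
            (flip (c (flip (gen (x, y)))) - beta y x *: gen (y, x)).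
Proof.
have -> : gen (y, x) = flip (gen (x, y)) :> {malg k[_]} by rewrite flipU.
rewrite -(linfZ (@flip_linear _ _ _)) -(linfB (@flip_linear _ _ _)) flipU flipE.
by apply: (supported_linext (c_tri y x)) => p yp; apply: supported_gen.
Qed.

End TriangularBraiding.

(** * Nonincreasing factorizations as decreasing lists with exponents *)

Section Blocks.

Variables (k : fieldType) (d : Order.disp_t) (X : finOrderType d).
Implicit Types (u s : seq X) (ls : seq (seq X)) (bl : seq (seq X * nat)).

Variable J : {malg k[{fmonom X}]} -> Prop.

Definition expand bl : seq (seq X) := flatten [seq nseq p.2 p.1 | p <- bl].

Definition decreasing bl : bool :=
  sorted (fun p q : seq X * nat => slt q.1 p.1) bl.

Let gt_trans : transitive (fun p q : seq X * nat => slt q.1 p.1).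
Proof. by move=> p q r qp pr; apply: slt_trans pr qp. Qed.

Lemma mem_expand u bl : u \in expand bl -> exists2 p, p \in bl & p.1 = u.
Proof.
by case/flatten_mapP => p pbl /nseqP[-> _]; exists p.
Qed.

Lemma expand_pbw bl : decreasing bl ->
  (forall p, p \in bl -> lyn p.1 /\ normal J (pw p.1 p.2)) ->
  pbw J (expand bl).
Proof.
rewrite /decreasing => blS blP; split; last 1 first.
- move=> l /mem_expand[p pbl <-].
  suff -> : count_mem p.1 (expand bl) = p.2 by have [] := blP p pbl.
  elim: bl blS pbl {blP} => [|q bl IHbl] //= qbl.
  have /allP qmin := order_path_min gt_trans qbl.
  have {}IHbl := IHbl (path_sorted qbl).
  rewrite /expand /= count_cat count_nseq inE -/(expand bl) => /orP[/eqP->|pbl].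
    rewrite /= eqxx mul1n [X in (_ + X)%N](_ : _ = 0%N) ?addn0 //.
    apply/count_memPn/negP => /mem_expand[r /qmin rq E].
    by rewrite E sltxx in rq.
  rewrite IHbl // /= (_ : (q.1 == p.1) = false) //.
  by apply/eqP => E; have := qmin p pbl; rewrite E sltxx.
- rewrite /noninc; elim: bl blS {blP} => [|q bl IHbl] //= qbl.
  have /allP qmin := order_path_min gt_trans qbl.
  have := IHbl (path_sorted qbl).
  rewrite !(sorted_pairwise (@nslt_trans _ X)) /expand /= pairwise_cat => ->.
  rewrite andbT; apply/andP; split.
    apply/allrelP => u v /nseqP[-> _] /mem_expand[p /qmin pq <-].
    by apply/negP => /(slt_trans pq); rewrite sltxx.
  by elim: (q.2) => //= m ->; rewrite andbT; apply/allP => u /nseqP[-> _]; rewrite sltxx.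
by move=> l /mem_expand[p /blP[pL _] <-].
Qed.

Lemma pbw_blocks ls : noninc ls -> exists bl,
  [/\ decreasing bl, expand bl = ls
    & forall p, p \in bl -> p.1 \in ls /\ p.2 = count_mem p.1 ls].
Proof.
have [n] := ubnP (size ls); elim: n ls => // n IHn [|u t] tn tS.
  by exists [::].
have := noninc_split u tS; set ls := u :: t in tS *; set r := filter (fun x => slt x u) ls.
have -> : filter (slt u) ls = [::].
  apply/eqP; rewrite -(negbK (_ == _)) -has_filter; apply/hasPn => x.
  have /allP tmin := order_path_min (@nslt_trans _ X) tS.
  by rewrite inE => /orP[/eqP->|/tmin //]; rewrite sltxx.
rewrite cat0s => lsE; have [||bl [blS blE blP]] := IHn r.
- rewrite -ltnS; apply: leq_trans tn; rewrite ltnS -/ls.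
  have -> : size ls = (count_mem u ls + size r)%N.
    by rewrite {1}lsE size_cat size_nseq.
  by rewrite -[X in (X < _)%N]add0n ltn_add2r /= eqxx.
- exact: (sorted_filter (@nslt_trans _ X)).
exists ((u, count_mem u ls) :: bl); split.
- rewrite /decreasing /= (path_sortedE gt_trans); apply/andP; split=> //.
  by apply/allP => p /blP[]; rewrite mem_filter => /andP[].
- by rewrite /expand /= -/(expand bl) blE -lsE.
move=> p; rewrite inE => /orP[/eqP->|/blP[]]; first by rewrite mem_head.
rewrite mem_filter => /andP[pu pls] ->; split=> //.
rewrite count_filter; apply: eq_count => x /=.
by case: eqVneq => [->|].
Qed.

End Blocks.

(** * Transport along the reversal and the PBW basis *)

Section Transfer.

Variables (k : fieldType) (d : Order.disp_t) (X : finOrderType d).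

Local Notation word := {fmonom X}.
Local Notation T := {malg k[{fmonom X}]}.
Local Notation phi := (@phi k d X).

Lemma gen_inj (A : choiceType) : injective (@gen k A).
Proof.
move=> a b /(congr1 (mcoeff b)); rewrite !mcoeff_gen eqxx.
by case: eqP => // _ /eqP; rewrite eq_sym oner_eq0.
Qed.

Lemma tmul_tens (a b : T) : tmul (tens a b) = a * b.
Proof.
rewrite /tmul lextE tens_tensor tensorE linext_linext malgMlinext.
apply: eq_linext => v; rewrite linext_linext; apply: eq_linext => w.
by rewrite linextU !genE malgMUU.
Qed.

Lemma phi_imageE (I : T -> Prop) b : phi_image I b <-> I (phi b).
Proof.
split=> [[a Ia <-]|Ib]; first by rewrite phiK.
by exists (phi b); rewrite ?phiK.
Qed.

Lemma phi_image_subspace (I : T -> Prop) : subspace I -> subspace (phi_image I).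
Proof.
case=> I0 ID IZ; split; first by apply/phi_imageE; rewrite (linf0 (@phi_linear k d X)).
  move=> a b /phi_imageE Ia /phi_imageE Ib; apply/phi_imageE.
  by rewrite (linfD (@phi_linear k d X)); apply: ID.
move=> x a /phi_imageE Ia; apply/phi_imageE.
by rewrite (linfZ (@phi_linear k d X)); apply: IZ.
Qed.

Lemma phi_image_ideal c (I : T -> Prop) : ideal (tensor_bialg c) I ->
  forall a b, phi_image I b -> phi_image I (a * b) /\ phi_image I (b * a).
Proof.
case=> _ IM a b /phi_imageE Ib; have [Il Ir] := IM (phi a) _ Ib.
by split; apply/phi_imageE; rewrite phiM -tmul_tens; [exact: Ir | exact: Il].
Qed.

Lemma revtens_tens_ideal (I : T -> Prop) z :
  tens_ideal I z -> tens_ideal (phi_image I) (revtens z).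
Proof.
case=> s sI ->; exists [seq (phi p.2, phi p.1) | p <- s].
  move=> _ /mapP[p /sI pI ->] /=.
  by case: pI => pI; [right | left]; apply/phi_imageE; rewrite phiK.
rewrite big_map (big_morph _ (linfD (@revtens_linear _ _ _)) (linf0 (@revtens_linear _ _ _))).
apply: eq_bigr => p _; rewrite !tens_tensor /revtens -flip_tmap_phi.
rewrite tmap_tensor ?flip_tensor //; exact: phi_linear.
Qed.

Lemma wpowE (u : word) t : wpow u t = FMonom (pw u t).
Proof.
by rewrite /wpow; elim: t => [|t IHt] /=; rewrite ?IHt ?mmulE // moneE.
Qed.

Lemma lyndonE (u : word) : lyndon u <-> lyn u.
Proof.
split=> -[u0 uL]; split.
- by apply/eqP => E; apply: u0; rewrite moneE -E fmK.
- move=> v w v0 w0 uE; apply: (uL (FMonom v) (FMonom w)).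
  + by rewrite moneE => -[E]; rewrite E in v0.
  + by rewrite moneE => -[E]; rewrite E in w0.
  by rewrite mmulE /= -uE fmK.
- by rewrite moneE => E; rewrite E in u0.
move=> v w v0 w0 uE; apply: (uL v w).
- by apply/eqP => E; apply: v0; rewrite moneE -E fmK.
- by apply/eqP => E; apply: w0; rewrite moneE -E fmK.
by rewrite uE mmulE.
Qed.

Section PBWBasis.

Variable J : T -> Prop.
Hypothesis J_sub : subspace J.
Hypothesis J_mul : forall a b, J b -> J (a * b) /\ J (b * a).

Lemma redu_pw u t e : (t <= e)%N -> redu J (pw u t) -> redu J (pw u e).
Proof.
move=> te /(redu_cat J_mul [::] (pw u (e - t))).
by rewrite cat0s -pwD subnKC.
Qed.

Lemma height_exists u : exists h, is_height J u h.
Proof.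
pose P t := reducible J (wpow u t) << wpow u t >>.
have [[t Pt]|nP] := classic (exists t, P t); last first.
  by exists None => /= t Pt; apply: nP; exists t.
have [n] := ubnP t; elim: n t Pt => // n IHn t Pt; rewrite ltnS => tn.
have [[t' [Pt' lt]]|tmin] := classic (exists t', P t' /\ (t' < t)%N).
  exact: IHn Pt' (leq_trans lt tn).
exists (Some t); split=> // t' Pt'; rewrite leqNgt; apply/negP => lt.
by apply: tmin; exists t'.
Qed.

(** A reducible power makes all higher powers reducible, so the normal powers of [u] are those below
    the least reducible exponent. *)
Lemma below_heightE (u : word) h e : is_height J u h ->
  below_height e h <-> normal J (pw u e).
Proof.
case: h => [t [Pt tmin]|nP] /=; last first.
  split=> // _ uP; apply: (nP e); rewrite wpowE.
  exact: (reducibleE J (pw u e)).2 uP.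
split=> [et uP|eN].
  have := tmin e; rewrite wpowE => /(_ ((reducibleE J (pw u e)).2 uP)).
  by rewrite leqNgt et.
rewrite ltnNge; apply/negP => te; apply: eN; apply: redu_pw te _.
by apply/(reducibleE J (pw u t)).1; rewrite -wpowE.
Qed.

(** [wd] inverts the map from words to elements of S, so that the order and the height can be total
    functions on T; its values on elements whose image is not a word are irrelevant. *)
Variables (wd : T -> word) (hh : word -> option nat).
Hypothesis wdP : forall s u, phi s = gen u -> wd s = u.
Hypothesis hhP : forall u, is_height J u (hh u).

Let S s := exists2 u, pbw_words J u & phi s = << u >>.
Let lt : rel T := fun s t => lex_lt (wd t) (wd s).
Let h s := hh (wd s).

Let SP s : S s -> [/\ phi s = gen (wd s), lyn (wd s) & normal J (wd s)].
Proof.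
case=> u [uL uN]; rewrite genE => su; rewrite (wdP su) su; split=> //.
  exact/lyndonE.
by move=> ur; apply: uN; have := (reducibleE J u).2 ur; rewrite fmK.
Qed.

(** The reversal compensates for [phi] being antimultiplicative; it also turns a product decreasing
    for the opposite order into a decreasing list of Lyndon words. *)
Let blocks_of (l : seq (T * nat)) : seq (seq X * nat) :=
  rev [seq (fmonom_val (wd p.1), p.2) | p <- l].

Let blocks_sorted l :
  sorted (fun p q : T * nat => lt q.1 p.1) l = decreasing (blocks_of l).
Proof. by rewrite /decreasing rev_sorted sorted_map. Qed.

Let phi_prod l : (forall p : T * nat, p \in l -> S p.1) ->
  phi (\prod_(p <- l) p.1 ^+ p.2) =
  gen (FMonom (flatten (expand (blocks_of l)))).
Proof.
elim: l => [|p l IHl] lS.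
  by rewrite big_nil phi1 malg1E.
rewrite big_cons phiM IHl; last by move=> q ql; apply: lS; rewrite inE ql orbT.
have [pE _ _] := SP (lS p (mem_head _ _)).
have pe e : gen (wd p.1) ^+ e = gen (FMonom (pw (wd p.1) e)) :> T.
  elim: e => [|e IHe]; first by rewrite expr0 malg1E.
  by rewrite exprS IHe malgMUU.
rewrite phiX pE pe malgMUU /blocks_of /= rev_cons -cats1 /expand.
by rewrite map_cat flatten_cat flatten_cat /= cats0.
Qed.

Hypothesis pbwE : forall s, normal J s <-> pbw_word J s.

Let wd_gen (w : word) : wd (gen (revw w)) = w.
Proof. by apply: wdP; rewrite phi_gen revwK. Qed.

Let pbw_setE b :
  pbw_set S lt h b <-> exists2 s, normal J s & phi b = gen (FMonom s).
Proof.
split=> [[l [lP lS ->]]|[s /pbwE[ls [lsS lsL lsN] lsE] bs]].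
  exists (flatten (expand (blocks_of l))); last first.
    by apply: phi_prod => p /lP[].
  apply/pbwE; exists (expand (blocks_of l)) => //; apply: expand_pbw.
    by rewrite -blocks_sorted.
  move=> q; rewrite mem_rev => /mapP[p /lP[/SP[_ pL _] _ pb] ->].
  by split=> //; apply/(below_heightE _ (hhP _)).
have [bl [blS blE blP]] := pbw_blocks lsS.
pose l := rev [seq (gen (revw (FMonom p.1)) : T, p.2) | p <- bl].
have lE : blocks_of l = bl.
  rewrite /blocks_of -map_rev /l revK -map_comp -[RHS]map_id.
  by apply: eq_map => -[u e]; rewrite /= wd_gen.
have lP p : p \in l -> [/\ S p.1, (0 < p.2)%N & below_height p.2 (h p.1)].
  rewrite mem_rev => /mapP[q /blP[qls qc] ->] /=.
  have qN := lsN _ qls; rewrite -qc in qN.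
  have q0 : (0 < q.2)%N by rewrite qc -has_count has_pred1.
  split=> //; last by rewrite /h wd_gen; apply/(below_heightE _ (hhP _)).
  exists (FMonom q.1); last by rewrite genE phi_gen revwK.
  split; first by apply/lyndonE; apply: lsL.
  (* The word [q.1] is the first power of itself, and a reducible first power would make the normal
     block of exponent [q.2 > 0] reducible. *)
  move/(reducibleE J q.1); rewrite -[q.1]cats0 -[q.1 ++ [::]]/(pw q.1 1).
  by move/(redu_pw q0).
exists l; split=> //.
  by rewrite blocks_sorted lE.
apply: (can_inj (@phiK k d X)); rewrite phi_prod => [|p /lP[]//].
by rewrite lE blE lsE.
Qed.

(** Under [phi] the PBW set becomes the set of normal words, so the two halves are [normal_indep]
    and [normal_form_exists]. *)
Lemma pbw_basis (I : T -> Prop) : (forall b, J b <-> I (phi b)) ->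
  basis_mod I (pbw_set S lt h).
Proof.
move=> JI; split=> [s x s_uniq sB Is b bs|a].
  have wdB b' : b' \in s -> phi b' = gen (wd b') /\ normal J (wd b').
    move=> /sB/pbw_setE[w wN bw].
    by rewrite (wdP bw).
  have phis : phi (\sum_(b <- s) x b *: b) = \sum_(b <- s) x b *: gen (wd b).
    rewrite (big_morph _ (linfD (@phi_linear k d X)) (linf0 (@phi_linear k d X))).
    apply: eq_big_seq => b' /wdB[bE _].
    by rewrite (linfZ (@phi_linear k d X)) bE.
  have z0 : \sum_(b <- s) x b *: gen (wd b) = 0 :> T.
    apply: (normal_indep J_sub).
      apply: supported_sum => b' /wdB[_ bN].
      by apply: supportedZ; apply: supported_gen.
    by apply/JI; rewrite -phis phiK.
  have := congr1 (mcoeff (wd b)) z0; rewrite mcoeff0 raddf_sum /=.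
  rewrite (bigD1_seq b) //= mcoeffZ mcoeff_gen eqxx mulr1 big_seq_cond big1 ?addr0 //.
  move=> b' /andP[b's b'b]; rewrite mcoeffZ mcoeff_gen.
  case: eqP => [wE|_]; last by rewrite mulr0.
  case/eqP: b'b; apply: (can_inj (@phiK k d X)).
  by rewrite (wdB _ b's).1 (wdB _ bs).1 wE.
have [z [zP Jz]] : exists z, wsupp (normal J) z /\ J (phi a - z).
  pose R a := exists z, wsupp (normal J) z /\ J (a - z).
  have [J0 JD JZ] := J_sub.
  apply: (wsupp_span (P := fun=> True) (R := R)); last by split.
  - by exists 0; rewrite subrr; split=> //; apply: wsupp0.
  - move=> y y' [z [zP Jz]] [z' [zP' Jz']]; exists (z + z').
    by split; [apply: wsuppD | rewrite opprD addrACA; apply: JD].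
  - move=> x y [z [zP Jz]]; exists (x *: z).
    by split; [apply: wsuppZ | rewrite -scalerBr; apply: JZ].
  move=> t _; have [z [zP Jz]] := normal_form_exists J_sub t.
  by exists z; split=> //; apply: wsuppW zP _ => r [].
exists [seq gen (revw w) | w : word <- msupp z], (fun b => z@_(wd b)); split.
  move=> _ /mapP[w wz ->]; apply/pbw_setE; exists (fmonom_val w).
    exact: supportedP zP wz.
  by rewrite phi_gen revwK fmK.
rewrite big_map; have -> : \sum_(w <- msupp z) z@_(wd (gen (revw w)))
    *: gen (revw w) = phi z.
  by rewrite phiE linextE; apply: eq_bigr => w _; rewrite wd_gen.
rewrite -[a](@phiK k d X) -(linfB (@phi_linear k d X)).
exact/JI.
Qed.

End PBWBasis.

End Transfer.

Theorem theorem45 (k : fieldType) (d : Order.disp_t) (X : finOrderType d)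
    (c : {linear {malg k[(X * X)%type]} -> {malg k[(X * X)%type]}})
    (c_bij : bijective c)
    (c_braid : braid_equation c)
    (c_tri : right_triangular c)
    (I : {malg k[{fmonom X}]} -> Prop)
    (I_biideal : braided_biideal (tensor_bialg c) I)
    (I_proper : exists a, ~ I a) :
  let J := phi_image I in
  braided_bialg_iso (tensor_bialg c)
    (opcop (tensor_bialg (fun z => flip (c (flip z))))) (@phi k d X) /\
  exists (S : {malg k[{fmonom X}]} -> Prop) (lt : rel {malg k[{fmonom X}]})
      (h : {malg k[{fmonom X}]} -> option nat),
    [/\ strict_total_order_on S lt,
        basis_mod I (pbw_set S lt h),
        forall s, S s <-> exists2 u, pbw_words J u & phi s = << u >>,
        forall s u, S s -> phi s = << u >> -> is_height J u (h s)
      & forall s t u v, S s -> S t -> phi s = << u >> -> phi t = << v >> ->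
          lt s t = lex_lt v u].
Proof.
move=> J; split; first exact: phi_iso.
have [beta [w cE]] := c_tri.
have c_lin : linear c by exact: linearP.
have c_rt x y : supported (fun p : X * X => (x < p.2)%O)
    (c (gen (x, y)) - beta x y *: gen (y, x)).
  rewrite -!genE cE addrAC subrr add0r.
  rewrite -big_filter; apply: supported_sum => z.
  rewrite mem_filter => /andP[xz _]; rewrite tens_tensor tensorE.
  apply: (supported_linext (P := fun=> True)) => // v _.
  by rewrite genE linextU; apply: supported_gen.
have beta0 := triangular_neq0 c_lin (bij_inj c_bij) c_rt.
have c'_lt := flip_triangular c_rt.
have [I_ideal [I_sub I_co _] _] := I_biideal.
have J_sub : subspace J := phi_image_subspace I_sub.
have J_mul : forall a b, J b -> J (a * b) /\ J (b * a) := phi_image_ideal I_ideal.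
(* An ideal containing 1 is everything, and then I would not be proper. *)
have J1 : ~ J 1.
  case: I_proper => a Ia J1; apply: Ia; rewrite -[a](@phiK k d X).
  by apply/phi_imageE; rewrite -[phi a]mulr1; apply: (J_mul _ _ J1).1.
pose c' z := flip (c (flip z)).
have J_co a : J a -> tens_ideal J (coprod c' a).
  case=> b Ib <-; rewrite -(revtens_coprod (c := c)); last first.
    by move=> x y; apply: flip_braidingE.
  by apply: revtens_tens_ideal; rewrite -tdeltaE; apply: I_co.
(* The flip on both sides of [c] exchanges the two indices of the diagonal coefficients. *)
have pbwE := normal_pbw_word (g := fun x y => beta y x) c'_lt
  (fun x y => beta0 y x) J_sub J_mul J1 J_co.
(* The default [mone] serves only elements that [phi] does not send to a word; no element of S is of
   this kind. *)
have wd_ex (s : {malg k[{fmonom X}]}) : exists v : {fmonom X},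
    (exists u, phi s = gen u) -> phi s = gen v.
  by have [[u su]|su] := classic (exists u, phi s = gen u);
    [exists u | exists mone].
have [wd wdP'] := epsilon_choice wd_ex.
have wdP s u : phi s = gen u -> wd s = u.
  by move=> su; apply: (@gen_inj k _); rewrite -su -wdP' //; exists u.
have [hh hhP] := epsilon_choice (height_exists J).
exists (fun s => exists2 u, pbw_words J u & phi s = << u >>).
exists (fun s t => lex_lt (wd t) (wd s)), (fun s => hh (wd s)).
have wdE s u : phi s = << u >> -> wd s = u by rewrite genE; apply: wdP.
split.
- split.
  + by move=> s _; rewrite -[lex_lt _ _]/(slt _ _) sltxx.
  + by move=> s t u _ _ _ st tu; apply: (slt_trans tu st).
  + move=> s t [u _ su] [v _ tv] st; rewrite (wdE _ _ su) (wdE _ _ tv).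
    have uv : (u : seq X) != v.
      apply/eqP => uv; apply: st; apply: (can_inj (@phiK k d X)).
      by rewrite su tv -[u]fmK uv fmK.
    have := slt_total (u : seq X) v; rewrite (negbTE uv) /= => /orP[|]; by [right | left].
- apply: (pbw_basis J_sub J_mul wdP hhP) => [s|b]; first exact: pbwE.
  exact: phi_imageE.
- by [].
- by move=> s u _ su; rewrite (wdE _ _ su); apply: hhP.
by move=> s t u v _ _ su tv; rewrite (wdE _ _ su) (wdE _ _ tv).
Qed.
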